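(* Let $4<p<\infty$. There exist $f\in L_p(\mathbb{R})$ and $\Lambda\subseteq\mathbb{Z}$ such that $(f_{(\lambda)})_{\lambda\in\Lambda}$ is an unconditional basic sequence and $X_p(f,\Lambda)$ contains a subspace isomorphic to $L_p(\mathbb{R})$.
   Context: $f_{(\lambda)}(x)=f(x-\lambda)$, and $X_p(f,\Lambda)$ denotes the closed linear span in $L_p(\mathbb{R})$ of $\{f_{(\lambda)}:\lambda\in\Lambda\}$. Unconditional basic sequence: an unconditional Schauder basis of its closed linear span. *)

(* Defs.v *)
From HB Require Import structures.
From mathcomp Require Import all_boot all_order all_algebra.
From mathcomp Require Import all_classical all_reals all_analysis.
Set Implicit Arguments. Unset Strict Implicit. Unset Printing Implicit Defensive.
Import Order.TTheory GRing.Theory Num.Theory.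
Local Open Scope classical_set_scope.
Local Open Scope ring_scope.

Section LpDefs.
Variable R : realType.

Definition Lpnorm (p : R) (f : R -> R) : \bar R :=
  Lnorm (@lebesgue_measure R) p%:E (EFin \o f).

Definition inLp (p : R) (f : R -> R) : Prop :=
  measurable_fun [set: R] f /\ (Lpnorm p f < +oo)%E.

Definition translate (f : R -> R) (l : int) : R -> R :=
  fun x => f (x - l%:~R).

Definition lincomb (f : R -> R) (F : seq int) (a : int -> R) : R -> R :=
  fun x => \sum_(l <- F) a l * translate f l x.

Definition finsub (Lam : set int) (F : seq int) : Prop :=
  uniq F /\ {subset F <= Lam}.

Definition Xp (p : R) (f : R -> R) (Lam : set int) : set (R -> R) :=
  [set g | inLp p g /\
     forall e : R, 0 < e -> exists F a, finsub Lam F /\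
        (Lpnorm p (fun x => (g x - lincomb f F a x)%R) < e%:E)%E].

(* sum_{l in Lambda} a_l f_(l) converges unconditionally to g in L_p
   (net convergence along the finite subsets of Lambda) *)
Definition uncond_sum_to (p : R) (f : R -> R) (Lam : set int) (a : int -> R)
    (g : R -> R) : Prop :=
  forall e : R, 0 < e -> exists F0, finsub Lam F0 /\
    forall F, finsub Lam F -> {subset F0 <= F} ->
      (Lpnorm p (fun x => (g x - lincomb f F a x)%R) < e%:E)%E.

(* (f_(l))_{l in Lambda} is an unconditional basic sequence in L_p(R), i.e. an
   unconditional Schauder basis of its closed linear span X_p(f, Lambda):
   each element of the span has a unique (coefficients on Lambda)
   unconditionally convergent expansion. *)
Definition uncond_basic (p : R) (f : R -> R) (Lam : set int) : Prop :=
  forall g, Xp p f Lam g ->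
    (exists a, uncond_sum_to p f Lam a g) /\
    (forall a b, uncond_sum_to p f Lam a g -> uncond_sum_to p f Lam b g ->
       forall l, Lam l -> a l = b l).

(* X contains a subspace isomorphic to L_p(R): there is a linear isomorphic
   embedding T of L_p(R) into X (linearity up to a.e. equality, i.e. up to
   L_p-norm zero; two-sided norm bounds). *)
Definition contains_Lp_copy (p : R) (X : set (R -> R)) : Prop :=
  exists (T : (R -> R) -> (R -> R)) (c C : R), 0 < c /\ 0 < C /\
    (forall g, inLp p g -> X (T g)) /\
    (forall g h (k : R), inLp p g -> inLp p h ->
       Lpnorm p (fun x => T (fun y => k * g y + h y) x - (k * T g x + T h x)) = 0%E) /\
    (forall g, inLp p g ->
       (c%:E * Lpnorm p g <= Lpnorm p (T g))%E /\
       (Lpnorm p (T g) <= C%:E * Lpnorm p g)%E).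

End LpDefs.

(* Main.v *)
(* The translates are indexed by lam_m = 4^(2m).  The function f is a sum of
   pieces g_m placed so that the translate of f by lam_m restricts, on the unit
   columns starting at the integers 4^(2j+1), to
     g_m = a_m * (indicator of a dyadic interval) * (m-th Rademacher function).
   Because base-4 digits are unique, everything else in these translates has
   pairwise disjoint supports off the columns, so the p-th power of the norm of
   a combination with coefficients b_m is the one of sum_m b_m g_m plus a
   weighted sum of the |b_m|^p.  The first term is a norm of a dyadic martingale,
   hence is equivalent to that of its square function, which depends on |b_m|
   only: this gives unconditionality.
     For every Haar function h_i take a block of n_i^4 indices m whose dyadic
   interval is the support of h_i and whose amplitude a_m is 1/n_i.  Mapping h_i
   to 1/n_i times the sum of the translates in its block preserves square
   functions, since n_i^4 (1/n_i)^2 (1/n_i)^2 = 1, while the extra l_p-term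
   involves only n_i^4 (1/n_i)^p = n_i^(4-p), which is as small as we like
   because p > 4.  So the span of the Haar functions, which is dense in L_p(R),
   is embedded isomorphically.
     The square function inequalities need no maximal function: d_n^2 depends
   only on the first n - 1 binary digits, which allows induction on n, and
   Young's inequality is used to absorb terms. *)
Require Import Defs.
From HB Require Import structures.
From mathcomp Require Import all_boot all_order all_algebra.
From mathcomp Require Import all_classical all_reals all_analysis.
From mathcomp Require Import measurable_realfun ring lra zify.
Import Order.TTheory GRing.Theory Num.Theory.
Import numFieldNormedType.Exports.
Set Implicit Arguments. Unset Strict Implicit. Unset Printing Implicit Defensive.
Local Open Scope classical_set_scope.
Local Open Scope ring_scope.

(** * Square functions of dyadic martingales *)

(** The threshold p > 4 arises as follows. The translate by lam_m also carries every other piece of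
    f, so off the columns its norm is only known to be at most 1; the coefficients inside a block
    must therefore be small themselves. The amplitudes must be small too, since the sum of their
    p-th powers is what bounds the norm of f. Making both equal to 1/n costs n^4 indices per block,
    and the remainder n^(4-p) can then be made small only if p > 4. How small it must be is dictated
    by h_i: the remainder |c_i|^p n_i^(4-p) has to stay below |c_i|^p times the length of the
    support of h_i, a quantity that the square function dominates because t^(p/2) is superadditive.
    This is ensured by n_i^(4-p) <= 2^(-i-1) and an enumeration in which the support of h_i has
    level at most i. Every index gets its own Rademacher function because the intervals of different
    indices come in no particular order. As the interval of g_m has level at most m, g_m is a sign
    read from a new digit times a function of the earlier digits, so every combination is a dyadic
    martingale. *)

Section PowerInequalities.
Variable R : realType.
Implicit Types (a b c r u v x : R).

Lemma powR_tangent r u v : 1 < r -> 0 <= u -> 0 <= v ->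
  r * u `^ (r - 1) * (v - u) <= v `^ r - u `^ r.
Proof.
move=> r1 u0 v0.
have r0 : 0 < r by lra.
have q0 : 0 < r / (r - 1) by rewrite divr_gt0 // subr_gt0.
have h : r^-1 + (r / (r - 1))^-1 = 1 by field; apply/andP; split; lra.
have := conjugate_powR v0 (powR_ge0 u (r - 1)) r0 q0 h.
rewrite -powRrM (_ : (r - 1) * (r / (r - 1)) = r); last by field; lra.
move=> yg.
have uE : u `^ (r - 1) * u = u `^ r by rewrite mulrC mulr_powRB1.
have : r * (v * u `^ (r - 1)) <= v `^ r + (r - 1) * u `^ r.
  apply: le_trans (_ : r * (v `^ r / r + u `^ r / (r / (r - 1))) <= _).
    by rewrite ler_wpM2l // ltW.
  by rewrite le_eqVlt; apply/orP; left; apply/eqP; field; apply/andP; split; lra.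
rewrite mulrBr -[r * _ * u]mulrA uE; lra.
Qed.

Lemma powR_addl_le r a b : 1 < r -> 0 <= a -> 0 <= b ->
  (a + b) `^ r <= a `^ r + r * (a + b) `^ (r - 1) * b.
Proof.
move=> r1 a0 b0; have := powR_tangent r1 (addr_ge0 a0 b0) a0.
rewrite (_ : a - (a + b) = - b); last ring.
by rewrite mulrN; lra.
Qed.

Lemma powR_superadditive r a b : 1 < r -> 0 <= a -> 0 <= b ->
  a `^ r + b `^ r <= (a + b) `^ r.
Proof.
move=> r1 a0 b0; have r0 : 0 < r by lra.
have r10 : 0 <= r - 1 by lra.
rewrite -!(mulr_powRB1 _ r0) ?addr_ge0 // mulrDl lerD // ler_wpM2l //;
  by rewrite ge0_ler_powR // ?nnegrE ?addr_ge0 // ?lerDl ?lerDr.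
Qed.

(** If [v <= e * u] the first term alone suffices; otherwise [u < e^-1 * v] and the second one
    does. *)
Lemma powR_young (e : R) r u v : 0 < e -> 1 < r -> 0 <= u -> 0 <= v ->
  u `^ (r - 1) * v <= e * u `^ r + (e^-1) `^ (r - 1) * v `^ r.
Proof.
move=> e0 r1 u0 v0; have r0 : 0 < r by lra.
have r10 : 0 <= r - 1 by lra.
have ei : 0 <= e^-1 by rewrite invr_ge0 ltW.
have [vu|uv] := lerP v (e * u).
  apply: le_trans (_ : e * u `^ r <= _); last first.
    by rewrite lerDl mulr_ge0 ?powR_ge0.
  rewrite -(mulr_powRB1 u0 r0) mulrA [leRHS]mulrC ler_wpM2l ?powR_ge0 //.
apply: le_trans (_ : (e^-1) `^ (r - 1) * v `^ r <= _); last first.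
  by rewrite lerDr mulr_ge0 ?powR_ge0 // ltW.
rewrite -(mulr_powRB1 v0 r0) [v * _]mulrC mulrA ler_wpM2r //.
rewrite -powRM // ge0_ler_powR // ?nnegrE ?mulr_ge0 //.
by rewrite ler_pdivlMl // ltW.
Qed.

(** Tangent lines at [x ^+ 2]: the terms linear in [c] cancel and the remaining one is
    nonnegative. *)
Lemma powR_sq_convex r x c : 1 < r ->
  2 * (x ^+ 2) `^ r <= ((x + c) ^+ 2) `^ r + ((x - c) ^+ 2) `^ r.
Proof.
move=> r1.
have h1 := powR_tangent r1 (sqr_ge0 x) (sqr_ge0 (x + c)).
have h2 := powR_tangent r1 (sqr_ge0 x) (sqr_ge0 (x - c)).
have h3 : 0 <= r * (x ^+ 2) `^ (r - 1) * c ^+ 2.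
  by rewrite mulr_ge0 ?sqr_ge0 // mulr_ge0 ?powR_ge0 //; lra.
have : r * (x ^+ 2) `^ (r - 1) * ((x + c) ^+ 2 - x ^+ 2) +
       r * (x ^+ 2) `^ (r - 1) * ((x - c) ^+ 2 - x ^+ 2) =
       2 * (r * (x ^+ 2) `^ (r - 1) * c ^+ 2) by ring.
lra.
Qed.

(** The powers of 4 come from bounding [(x + c) ^+ 2] by four times the larger of [x ^+ 2] and
    [c ^+ 2], with exponents [r - 2] and [r - 1]. *)
Definition Cstep r : R := r * (4 * (r - 1) * 4 `^ (r - 2) + 4 `^ (r - 1)).

Lemma Cstep_ge0 r : 2 < r -> 0 <= Cstep r.
Proof.
by move=> r2; rewrite mulr_ge0 ?addr_ge0 ?mulr_ge0 ?powR_ge0 //; lra.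
Qed.

(** Tangent lines at the new points [U] and [V] leave terms with a factor [c ^+ 2] and a first-order
    part, [2 * (x * c)] times [r * (U ^ (r - 1) - V ^ (r - 1))]. A second tangent inequality, of
    exponent [r - 1], makes this part second order in [c]; it requires [1 < r - 1]. *)
Let powR_sq_step_pos r x c : 2 < r -> 0 <= x * c ->
  ((x + c) ^+ 2) `^ r + ((x - c) ^+ 2) `^ r - 2 * (x ^+ 2) `^ r <=
  2 * (Cstep r * ((x ^+ 2) `^ (r - 1) * c ^+ 2 + (c ^+ 2) `^ r)).
Proof.
move=> r2 xc; have r1 : 1 < r by lra.
have r11 : 1 < r - 1 by lra.
set U := (x + c) ^+ 2; set V := (x - c) ^+ 2; set X := x ^+ 2.
set b := c ^+ 2.
have U0 : 0 <= U by rewrite sqr_ge0.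
have V0 : 0 <= V by rewrite sqr_ge0.
have X0 : 0 <= X by rewrite sqr_ge0.
have b0 : 0 <= b by rewrite sqr_ge0.
have h1 : U `^ r - X `^ r <= r * U `^ (r - 1) * (U - X).
  by have := powR_tangent r1 U0 X0; rewrite -[X - U]opprB mulrN; lra.
have h2 : V `^ r - X `^ r <= r * V `^ (r - 1) * (V - X).
  by have := powR_tangent r1 V0 X0; rewrite -[X - V]opprB mulrN; lra.
have h3 : U `^ (r - 1) - V `^ (r - 1) <= (r - 1) * U `^ (r - 2) * (4 * (x * c)).
  have := powR_tangent r11 U0 V0.
  rewrite (_ : r - 1 - 1 = r - 2); last ring.
  rewrite (_ : V - U = - (4 * (x * c))); last by rewrite /U /V; ring.
  by rewrite mulrN; lra.
have VU : V <= U by rewrite /U /V; nra.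
have h4 : V `^ (r - 1) <= U `^ (r - 1) by rewrite ge0_ler_powR // ?nnegrE; lra.
have h5 : U `^ r + V `^ r - 2 * X `^ r <=
    r * (8 * (r - 1) * U `^ (r - 2) * (X * b) + 2 * U `^ (r - 1) * b).
  have e1 : U - X = 2 * (x * c) + b by rewrite /U /X /b; ring.
  have e2 : V - X = - 2 * (x * c) + b by rewrite /V /X /b; ring.
  have : r * U `^ (r - 1) * (U - X) + r * V `^ (r - 1) * (V - X) <=
     r * (8 * (r - 1) * U `^ (r - 2) * (X * b) + 2 * U `^ (r - 1) * b).
    rewrite -!mulrA -mulrDr ler_wpM2l ?e1 ?e2 //; first lra.
    have k1 : (U `^ (r - 1) - V `^ (r - 1)) * (2 * (x * c)) <=
       (r - 1) * U `^ (r - 2) * (4 * (x * c)) * (2 * (x * c)).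
      by rewrite ler_wpM2r // mulr_ge0.
    have k2 : V `^ (r - 1) * b <= U `^ (r - 1) * b by rewrite ler_wpM2r.
    have k3 : (r - 1) * U `^ (r - 2) * (4 * (x * c)) * (2 * (x * c)) =
       8 * ((r - 1) * (U `^ (r - 2) * (X * b))) by rewrite /X /b; ring.
    have k4 : x * (x * b) = X * b by rewrite /X; ring.
    by move: k1 k2; rewrite k3 k4; clear; lra.
  by lra.
apply: le_trans h5 _.
have UXb : U <= 2 * X + 2 * b.
  by rewrite /U /X /b; have := sqr_ge0 (x - c); nra.
clear h1 h2 h3 h4 VU xc; clearbody U V X b.
(* With [Z] the larger of [X] and [b], the product [Z ^ (r - 1) * b] is one of the two terms on the
   right, so mixed terms need only be bounded by it. *)
pose Z := if b <= X then X else b.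
have ZE : Z `^ (r - 1) * b <= X `^ (r - 1) * b + b `^ r.
  rewrite /Z; case: ifP => _; first by rewrite lerDl powR_ge0.
  have -> : b `^ (r - 1) * b = b `^ r by rewrite mulrC mulr_powRB1 //; lra.
  by rewrite lerDr mulr_ge0 // powR_ge0.
have bZ : b <= Z by rewrite /Z; case: ifP => //.
have XZ : X <= Z by rewrite /Z; case: (lerP b X) => // /ltW.
have Z0 : 0 <= Z by apply: le_trans bZ.
have UZ : U <= 4 * Z by lra.
clearbody Z.
have k1 : U `^ (r - 2) <= 4 `^ (r - 2) * Z `^ (r - 2).
  by rewrite -powRM // ge0_ler_powR // ?nnegrE ?mulr_ge0 //; lra.
have k2 : U `^ (r - 1) <= 4 `^ (r - 1) * Z `^ (r - 1).
  by rewrite -powRM // ge0_ler_powR // ?nnegrE ?mulr_ge0 //; lra.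
have k3 : U `^ (r - 2) * (X * b) <= 4 `^ (r - 2) * (Z `^ (r - 1) * b).
  apply: le_trans (_ : 4 `^ (r - 2) * Z `^ (r - 2) * (X * b) <= _).
    by rewrite ler_wpM2r // mulr_ge0.
  rewrite -!mulrA ler_wpM2l ?powR_ge0 // mulrA ler_wpM2r //.
  have <- : Z * Z `^ (r - 2) = Z `^ (r - 1).
    have rE : r - 2 = r - 1 - 1 by ring.
    by rewrite rE mulr_powRB1 //; lra.
  by rewrite [leRHS]mulrC ler_wpM2l ?powR_ge0.
have k4 : U `^ (r - 1) * b <= 4 `^ (r - 1) * (Z `^ (r - 1) * b).
  by rewrite mulrA ler_wpM2r.
apply: le_trans (_ : 2 * (Cstep r * (Z `^ (r - 1) * b)) <= _); last first.
  by rewrite ler_wpM2l // ler_wpM2l // Cstep_ge0.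
rewrite /Cstep -!mulrA [2 * (r * _)]mulrCA ler_wpM2l //; first lra.
have k5 : (r - 1) * (U `^ (r - 2) * (X * b)) <= (r - 1) * (4 `^ (r - 2) * (Z `^ (r - 1) * b)).
  by rewrite ler_wpM2l //; lra.
by lra.
Qed.

Lemma powR_sq_step r x c : 2 < r ->
  ((x + c) ^+ 2) `^ r + ((x - c) ^+ 2) `^ r - 2 * (x ^+ 2) `^ r <=
  2 * (Cstep r * ((x ^+ 2) `^ (r - 1) * c ^+ 2 + (c ^+ 2) `^ r)).
Proof.
move=> r2; have [xc|xc] := lerP 0 (x * c); first exact: powR_sq_step_pos.
have := @powR_sq_step_pos r x (- c) r2.
rewrite mulrN oppr_ge0 => /(_ (ltW xc)).
by rewrite opprK sqrrN [X in X - _]addrC.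
Qed.

End PowerInequalities.

Section DyadicMartingale.
Variables (R : realType) (f0 : nat -> R) (c : nat -> nat -> R).

(* Dyadic intervals of level n are numbered by t, so that the parent of t is t./2
   and the lower child of t is t.*2; at level 0 there is one interval per
   integer.  A martingale is given by its start f0 and by the function c n on
   level-n intervals, its increments from level n to n + 1 being +c n and -c n. *)
Fixpoint dmart n t : R :=
  if n is n'.+1 then dmart n' t./2 + (-1) ^+ odd t * c n' t./2 else f0 t.

Fixpoint sqfun n t : R :=
  if n is n'.+1 then sqfun n' t./2 + c n' t./2 ^+ 2 else f0 t ^+ 2.

Lemma sqfun_ge0 n t : 0 <= sqfun n t.
Proof. by elim: n t => [|n IH] t /=; rewrite ?addr_ge0 ?sqr_ge0. Qed.

Lemma sum_halves (F : nat -> R) J n :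
  \sum_(t < J * 2 ^ n.+1) F t = \sum_(t < J * 2 ^ n) (F t.*2 + F t.*2.+1).
Proof.
rewrite expnS mulnCA; elim: (J * 2 ^ n)%N => [|K IH]; first by rewrite !big_ord0.
by rewrite mulnS !big_ord_recr /= IH mul2n addrA.
Qed.

Variable r : R.

(* The weight [sqfun n `^ (r - 1)] is predictable and nondecreasing in n, so
   both sides can be compared one level at a time. *)
Lemma sqfun_le_weighted J n : 2 < r ->
  \sum_(t < J * 2 ^ n) sqfun n t `^ r <=
  r * \sum_(t < J * 2 ^ n) sqfun n t `^ (r - 1) * dmart n t ^+ 2.
Proof.
move=> r2.
elim: n => [|n IH].
  rewrite mulr_sumr; apply: ler_sum => t _ /=.
  have -> : (f0 t ^+ 2) `^ (r - 1) * f0 t ^+ 2 = (f0 t ^+ 2) `^ r.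
    rewrite mulrC mulr_powRB1 ?sqr_ge0 //; lra.
  by rewrite ler_peMl ?powR_ge0 //; lra.
rewrite (sum_halves (fun t => sqfun n.+1 t `^ r)).
rewrite (sum_halves (fun t => sqfun n.+1 t `^ (r - 1) * dmart n.+1 t ^+ 2)).
rewrite -subr_le0 mulr_sumr -sumrB.
move: IH; rewrite -subr_le0 mulr_sumr -sumrB => IH.
(* Each interval has two children, hence the factor 2 on the induction hypothesis. *)
apply: le_trans (_ : 2 * (\sum_(i < J * 2 ^ n) (sqfun n i `^ r -
      r * (sqfun n i `^ (r - 1) * dmart n i ^+ 2))) <= _); last by lra.
rewrite mulr_sumr; apply: ler_sum => t _.
rewrite /= !odd_double /= doubleK uphalf_double.
set a := sqfun n t; set b := c n t ^+ 2; set x := dmart n t.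
have a0 : 0 <= a by exact: sqfun_ge0.
have b0 : 0 <= b by exact: sqr_ge0.
have h1 : (a + b) `^ r <= a `^ r + r * (a + b) `^ (r - 1) * b.
  by apply: powR_addl_le => //; lra.
have h2 : a `^ (r - 1) * x ^+ 2 <= (a + b) `^ (r - 1) * x ^+ 2.
  by rewrite ler_wpM2r ?sqr_ge0 // ge0_ler_powR // ?nnegrE; lra.
(* The weight is the same on both children, so the cross terms cancel. *)
have h3 : (a + b) `^ (r - 1) * (x + (-1) ^+ 0 * c n t) ^+ 2 +
   (a + b) `^ (r - 1) * (x + (-1) ^+ 1 * c n t) ^+ 2 =
   2 * ((a + b) `^ (r - 1) * x ^+ 2) + 2 * ((a + b) `^ (r - 1) * b).
  by rewrite expr0 expr1 /b; ring.
have h4 : r * (a `^ (r - 1) * x ^+ 2) <= r * ((a + b) `^ (r - 1) * x ^+ 2).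
  by rewrite ler_wpM2l //; lra.
have h5 : r * ((a + b) `^ (r - 1) * (x + (-1) ^+ 0 * c n t) ^+ 2 +
   (a + b) `^ (r - 1) * (x + (-1) ^+ 1 * c n t) ^+ 2) =
   2 * (r * ((a + b) `^ (r - 1) * x ^+ 2)) + 2 * (r * ((a + b) `^ (r - 1) * b)).
  by rewrite h3; ring.
rewrite -[r * _ * b]mulrA in h1; lra.
Qed.

(* Passing to the next level, convexity makes the weights [(dmart n ^+ 2) `^ (r - 1)]
   increase on average, while [sqfun n.+1] is constant on the two children. *)
Lemma dmart_le_weighted J n : 2 < r ->
  \sum_(t < J * 2 ^ n) (dmart n t ^+ 2) `^ r <=
  (1 + Cstep r) * \sum_(t < J * 2 ^ n)
     ((dmart n t ^+ 2) `^ (r - 1) * sqfun n t + sqfun n t `^ r).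
Proof.
move=> r2.
have C0 := Cstep_ge0 r2.
elim: n => [|n IH].
  rewrite mulr_sumr; apply: ler_sum => t _ /=.
  have P0 := powR_ge0 (f0 t ^+ 2) r.
  have -> : (f0 t ^+ 2) `^ (r - 1) * f0 t ^+ 2 = (f0 t ^+ 2) `^ r.
    rewrite mulrC mulr_powRB1 ?sqr_ge0 //; lra.
  by nra.
rewrite (sum_halves (fun t => (dmart n.+1 t ^+ 2) `^ r)).
rewrite (sum_halves (fun t =>
  (dmart n.+1 t ^+ 2) `^ (r - 1) * sqfun n.+1 t + sqfun n.+1 t `^ r)).
rewrite -subr_le0 mulr_sumr -sumrB.
move: IH; rewrite -subr_le0 mulr_sumr -sumrB => IH.
set D := 1 + Cstep r in IH *.
apply: le_trans (_ : 2 * (\sum_(i < J * 2 ^ n) ((dmart n i ^+ 2) `^ r -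
      D * ((dmart n i ^+ 2) `^ (r - 1) * sqfun n i + sqfun n i `^ r))) <= _);
  last by lra.
rewrite mulr_sumr; apply: ler_sum => t _.
rewrite /= !odd_double /= doubleK uphalf_double expr0 expr1 mul1r mulN1r.
set a := sqfun n t; set x := dmart n t; set d := c n t; set b := d ^+ 2.
have a0 : 0 <= a by exact: sqfun_ge0.
have b0 : 0 <= b by exact: sqr_ge0.
have h1 := powR_sq_step x d r2.
have h2 : 2 * (x ^+ 2) `^ (r - 1) <= ((x + d) ^+ 2) `^ (r - 1) + ((x - d) ^+ 2) `^ (r - 1).
  by apply: powR_sq_convex; lra.
have h3 : a `^ r + b `^ r <= (a + b) `^ r by apply: powR_superadditive => //; lra.
have ab0 : 0 <= a + b by lra.
have h4 : 2 * (x ^+ 2) `^ (r - 1) * (a + b) <=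
   (((x + d) ^+ 2) `^ (r - 1) + ((x - d) ^+ 2) `^ (r - 1)) * (a + b).
  by rewrite ler_wpM2r.
have D0 : 0 <= D by rewrite /D; lra.
have h5 : D * (2 * (x ^+ 2) `^ (r - 1) * (a + b) + 2 * (a `^ r + b `^ r)) <=
  D * ((((x + d) ^+ 2) `^ (r - 1) + ((x - d) ^+ 2) `^ (r - 1)) * (a + b) +
   2 * (a + b) `^ r).
  by rewrite ler_wpM2l // lerD // ler_wpM2l.
have h6 : Cstep r * ((x ^+ 2) `^ (r - 1) * b + b `^ r) <=
   D * ((x ^+ 2) `^ (r - 1) * b + b `^ r).
  have CD : Cstep r <= D by rewrite /D; lra.
  apply: (ler_wpM2r _ CD); apply: addr_ge0; last exact: powR_ge0.
  by apply: mulr_ge0 => //; exact: powR_ge0.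
move: h1 h5 h6; rewrite -/b; lra.
Qed.

(** From [powR_young] with [e = (2 * r)^-1]: since [r * e = 1 / 2], half of the left-hand side, a
    finite sum, is absorbed, and the rest is doubled. [Cmart] arises in the same way with
    [1 + Cstep r] in place of [r]. *)
Definition Csq : R := 2 * r * (((2 * r)^-1)^-1 `^ (r - 1)).
Definition Cmart : R :=
  2 * (1 + Cstep r) * (((2 * (1 + Cstep r))^-1)^-1 `^ (r - 1) + 1).

Lemma Csq_gt0 : 2 < r -> 0 < Csq.
Proof.
move=> r2; have r0 : 0 < 2 * r by lra.
by rewrite /Csq invrK mulr_gt0 // powR_gt0.
Qed.

Lemma Cmart_gt0 : 2 < r -> 0 < Cmart.
Proof.
move=> r2.
have C0 := Cstep_ge0 r2.
have := powR_ge0 (((2 * (1 + Cstep r))^-1)^-1) (r - 1).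
by move=> h; rewrite /Cmart mulr_gt0 //; lra.
Qed.

Lemma sqfun_le_dmart J n : 2 < r ->
  \sum_(t < J * 2 ^ n) sqfun n t `^ r <=
  Csq * \sum_(t < J * 2 ^ n) (dmart n t ^+ 2) `^ r.
Proof.
move=> r2.
have h := sqfun_le_weighted J n r2.
set e := (2 * r)^-1.
have e0 : 0 < e by rewrite invr_gt0; lra.
have h2 : \sum_(t < J * 2 ^ n) sqfun n t `^ (r - 1) * dmart n t ^+ 2 <=
  e * (\sum_(t < J * 2 ^ n) sqfun n t `^ r) +
  (e^-1 `^ (r - 1)) * \sum_(t < J * 2 ^ n) (dmart n t ^+ 2) `^ r.
  rewrite !mulr_sumr -big_split; apply: ler_sum => t _.
  by apply: powR_young => //; [lra|exact: sqfun_ge0|exact: sqr_ge0].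
move: h h2; rewrite /Csq -/e.
set A := \sum_(t < _) _; set F := \sum_(t < _) _; set B := \sum_(t < _) _.
set k := _ `^ _ => h h2.
have r0 : 0 <= r by lra.
have := ler_wpM2l r0 h2.
have : r * (e * A + k * F) = A / 2 + r * k * F.
  by rewrite /e; field; lra.
by move: h; rewrite -(mulrA 2 r k) -(mulrA 2 (r * k) F); lra.
Qed.

Lemma dmart_le_sqfun J n : 2 < r ->
  \sum_(t < J * 2 ^ n) (dmart n t ^+ 2) `^ r <=
  Cmart * \sum_(t < J * 2 ^ n) sqfun n t `^ r.
Proof.
move=> r2.
have C0 := Cstep_ge0 r2.
have h := dmart_le_weighted J n r2.
set D := 1 + Cstep r in h.
have D1 : 1 <= D by rewrite /D; lra.
set e := (2 * D)^-1.
have e0 : 0 < e by rewrite invr_gt0; lra.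
have h2 : \sum_(t < J * 2 ^ n)
     ((dmart n t ^+ 2) `^ (r - 1) * sqfun n t + sqfun n t `^ r) <=
  e * (\sum_(t < J * 2 ^ n) (dmart n t ^+ 2) `^ r) +
  ((e^-1 `^ (r - 1)) + 1) * \sum_(t < J * 2 ^ n) sqfun n t `^ r.
  rewrite !mulr_sumr -big_split; apply: ler_sum => t _ /=.
  rewrite mulrDl mul1r addrA lerD2r.
  by apply: powR_young => //; [lra|exact: sqr_ge0|exact: sqfun_ge0].
move: h h2; rewrite /Cmart -/D -/e.
set A := \sum_(t < _) _; set F := \sum_(t < _) _; set B := \sum_(t < _) _.
set k := _ + 1 => h h2.
have D0 : 0 <= D by lra.
have := ler_wpM2l D0 h2.
have : D * (e * A + k * F) = A / 2 + D * k * F.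
  by rewrite /e; field; lra.
by move: h; rewrite -(mulrA 2 D k) -(mulrA 2 (D * k) F); lra.
Qed.

End DyadicMartingale.

(** * The space L_p(R) *)

Section LpSpace.
Variable R : realType.
Variable p : R.
Hypothesis p1 : 1 <= p.
Implicit Types (f g h : R -> R).

Local Notation mu := (@lebesgue_measure R).

(** The p-th power of the norm; unlike the norm, it is additive over functions with disjoint
    supports. *)
Definition pint f : \bar R := (\int[mu]_x (`|f x| `^ p)%:E)%E.

(** [fine] sends an infinite norm to 0, so [nrm] is meaningful only together with [inLp]. *)
Definition nrm f : R := fine (Lpnorm p f).

Let p0 : 0 < p. Proof. exact: lt_le_trans p1. Qed.

Let pN0 : p != 0. Proof. by rewrite gt_eqF. Qed.

Lemma LpnormE f : Lpnorm p f = poweR (pint f) p^-1.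
Proof.
by rewrite /Lpnorm unlock.
Qed.

Lemma pint_ge0 f : (0 <= pint f)%E.
Proof. by apply: integral_ge0 => x _; rewrite lee_fin powR_ge0. Qed.

Lemma inLpP f : inLp p f <-> measurable_fun [set: R] f /\ (pint f < +oo)%E.
Proof.
split=> -[mf h]; split=> //; move: h; rewrite LpnormE.
  by apply: lty_poweRy; rewrite invr_neq0.
exact: poweR_lty.
Qed.

Lemma Lpnorm_ge0 f : (0 <= Lpnorm p f)%E.
Proof. exact: Lnorm_ge0. Qed.

Lemma nrm_ge0 f : 0 <= nrm f.
Proof. by rewrite fine_ge0 // Lpnorm_ge0. Qed.

Lemma nrmE f : inLp p f -> Lpnorm p f = (nrm f)%:E.
Proof.
by move=> -[mf lf]; rewrite /nrm fineK // ge0_fin_numE // Lpnorm_ge0.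
Qed.

Lemma pintE f : inLp p f -> pint f = (nrm f `^ p)%:E.
Proof.
move=> lf; rewrite -poweR_EFin -nrmE // LpnormE -poweRrM mulVf //.
by rewrite poweRe1 // pint_ge0.
Qed.

Lemma nrm_le_pint f a : 0 <= a -> (pint f <= (a `^ p)%:E)%E -> nrm f <= a.
Proof.
move=> a0 fa.
have pf : pint f \is a fin_num.
  by rewrite ge0_fin_numE ?pint_ge0 // (le_lt_trans fa) // ltry.
rewrite /nrm LpnormE fine_poweR.
have : fine (pint f) <= a `^ p by rewrite -lee_fin fineK.
move=> h; have -> : a = (a `^ p) `^ p^-1 by rewrite -powRrM mulfV // powRr1.
by rewrite ge0_ler_powR // ?nnegrE ?powR_ge0 ?invr_ge0 ?fine_ge0 ?pint_ge0 // ltW.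
Qed.

Lemma nrm_le_scaled f g (A : R) : inLp p g -> 0 <= A ->
  (pint f <= A%:E * pint g)%E -> nrm f <= A `^ p^-1 * nrm g.
Proof.
move=> lg A0 h; apply: nrm_le_pint; first by rewrite mulr_ge0 ?powR_ge0 ?nrm_ge0.
rewrite powRM ?powR_ge0 ?nrm_ge0 // -powRrM mulVf // powRr1 // EFinM.
by rewrite -pintE.
Qed.

Lemma inLp0 : inLp p (fun=> 0).
Proof.
split; first exact: measurable_cst.
by rewrite /Lpnorm (Lnorm0 mu (p := p%:E)) // eqe.
Qed.

Lemma inLpD f g : inLp p f -> inLp p g -> inLp p (fun x => f x + g x).
Proof.
move=> [mf lf] [mg lg]; split; first exact: measurable_funD.
apply: le_lt_trans (lte_add_pinfty lf lg).
exact: (minkowski_EFin mu mf mg p1).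
Qed.

Lemma nrmD f g : inLp p f -> inLp p g ->
  nrm (fun x => f x + g x) <= nrm f + nrm g.
Proof.
move=> lf lg; rewrite -lee_fin EFinD -!nrmE //; last exact: inLpD.
exact: (minkowski_EFin mu lf.1 lg.1 p1).
Qed.

Lemma Lpnorm_Z f k : inLp p f ->
  Lpnorm p (fun x => k * f x) = (`|k|%:E * Lpnorm p f)%E.
Proof.
move=> [mf lf].
have fL : f \in Lfun mu p%:E.
  by rewrite inE; apply/andP; split; rewrite inE.
have p1' : (1 <= p%:E)%E by rewrite lee_fin.
exact: (LnormZ (Lfun_Sub p1' fL) k).
Qed.

Lemma inLpZ f k : inLp p f -> inLp p (fun x => k * f x).
Proof.
move=> lf; split; first exact: measurable_funM (measurable_cst _) lf.1.
by rewrite Lpnorm_Z // nrmE // -EFinM ltry.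
Qed.

Lemma nrmZ f k : inLp p f -> nrm (fun x => k * f x) = `|k| * nrm f.
Proof. by move=> lf; rewrite /nrm Lpnorm_Z // nrmE // -EFinM. Qed.

Lemma eq_inLp f g : f =1 g -> inLp p f -> inLp p g.
Proof. by move=> /funext ->. Qed.

Lemma eq_nrm f g : f =1 g -> nrm f = nrm g.
Proof. by move=> /funext ->. Qed.

Lemma inLpB f g : inLp p f -> inLp p g -> inLp p (fun x => f x - g x).
Proof.
move=> lf lg; apply: eq_inLp (inLpD lf (inLpZ (-1) lg)) => x /=.
by rewrite mulN1r.
Qed.

Lemma nrmN f g : inLp p f -> inLp p g ->
  nrm (fun x => f x - g x) = nrm (fun x => g x - f x).
Proof.
move=> lf lg; have := nrmZ (-1) (inLpB lf lg).
rewrite normrN1 mul1r => <-; apply: eq_nrm => x.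
by rewrite mulN1r opprB.
Qed.

Lemma nrm0 : nrm (fun=> 0) = 0.
Proof.
by have := nrmZ 0 inLp0; rewrite normr0 !mul0r.
Qed.

Lemma nrm_triangle g f h : inLp p f -> inLp p g -> inLp p h ->
  nrm (fun x => f x - h x) <= nrm (fun x => f x - g x) + nrm (fun x => g x - h x).
Proof.
move=> lf lg lh; apply: le_trans (nrmD (inLpB lf lg) (inLpB lg lh)).
by rewrite le_eqVlt; apply/orP; left; apply/eqP/eq_nrm => x; ring.
Qed.

Lemma nrm_leB f g : inLp p f -> inLp p g ->
  nrm f <= nrm g + nrm (fun x => f x - g x).
Proof.
move=> lf lg; apply: le_trans (nrmD lg (inLpB lf lg)).
by rewrite le_eqVlt; apply/orP; left; apply/eqP/eq_nrm => x; ring.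
Qed.

Lemma inLp_sum (I : Type) (s : seq I) (F : I -> R -> R) :
  (forall i, inLp p (F i)) -> inLp p (fun x => \sum_(i <- s) F i x).
Proof.
move=> lF; elim: s => [|i s IH].
  by apply: eq_inLp inLp0 => x; rewrite big_nil.
by apply: eq_inLp (inLpD (lF i) IH) => x; rewrite big_cons.
Qed.

Lemma nrm_sum (I : Type) (s : seq I) (F : I -> R -> R) :
  (forall i, inLp p (F i)) ->
  nrm (fun x => \sum_(i <- s) F i x) <= \sum_(i <- s) nrm (F i).
Proof.
move=> lF; elim: s => [|i s IH].
  by rewrite big_nil -[leRHS]nrm0 (eq_nrm (g := fun=> 0)) // => x; rewrite big_nil.
rewrite big_cons (eq_nrm (g := fun x => F i x + \sum_(j <- s) F j x)).
  by apply: le_trans (nrmD (lF i) (inLp_sum s lF)) _; rewrite lerD2l.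
by move=> x; rewrite big_cons.
Qed.

Lemma Lpnorm_lt f (e : R) : inLp p f -> (Lpnorm p f < e%:E)%E = (nrm f < e).
Proof. by move=> lf; rewrite nrmE // lte_fin. Qed.

End LpSpace.

(** * Completeness of L_p *)

Section LpCompleteness.
Variable R : realType.
Variable p : R.
Hypothesis p1 : 1 < p.

Local Notation mu := (@lebesgue_measure R).

Let p1' : 1 <= p. Proof. exact: ltW. Qed.
Let p0 : 0 < p. Proof. exact: lt_trans p1. Qed.

Lemma powR_lipschitz (B s t : R) : 0 <= s <= B -> 0 <= t <= B ->
  `|s `^ p - t `^ p| <= p * B `^ (p - 1) * `|s - t|.
Proof.
have pp : 0 <= p by exact: ltW.
have p11 : 0 <= p - 1 by rewrite subr_ge0.
wlog st : s t / s <= t => [hw sB tB|].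
  case/orP: (le_total s t) => [st|ts]; first exact: (hw _ _ st sB tB).
  by rewrite distrC (distrC s); exact: (hw _ _ ts tB sB).
move=> /andP[s0 sB] /andP[t0 tB].
rewrite distrC (distrC s) ger0_norm ?subr_ge0; last first.
  by rewrite ge0_ler_powR // nnegrE.
rewrite ger0_norm ?subr_ge0 //.
have h := powR_tangent p1 t0 s0.
have h2 : p * t `^ (p - 1) * (t - s) <= p * B `^ (p - 1) * (t - s).
  rewrite ler_wpM2r ?subr_ge0 // ler_wpM2l // ge0_ler_powR // nnegrE //.
  exact: le_trans tB.
have : p * t `^ (p - 1) * (s - t) = - (p * t `^ (p - 1) * (t - s)) by ring.
lra.
Qed.

Lemma cvg_powR (u : nat -> R) (l : R) : (forall n, 0 <= u n) -> 0 <= l ->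
  u @ \oo --> l -> (fun n => u n `^ p) @ \oo --> l `^ p.
Proof.
move=> u0 l0 ul; apply/cvgrPdist_le => e e0.
set K := p * (l + 1) `^ (p - 1) + 1.
have K0 : 0 < K.
  by rewrite /K ltr_pwDr // mulr_ge0 ?powR_ge0 // ltW.
have m0 : 0 < Num.min 1 (e / K) by rewrite lt_min ltr01 divr_gt0.
move/cvgrPdist_le : ul => /(_ _ m0); apply: filterS => n.
rewrite le_min => /andP[h1 h2].
have lB : 0 <= l <= l + 1 by rewrite l0 lerDl ler01.
have uB : 0 <= u n <= l + 1.
  by rewrite u0 /=; move: h1; rewrite ler_norml => /andP[h1 _]; lra.
apply: le_trans (powR_lipschitz lB uB) _.
apply: le_trans (_ : K * `|l - u n| <= _).
  by rewrite ler_wpM2r // /K lerDl.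
by rewrite mulrC -ler_pdivlMr.
Qed.

Lemma measurable_powR_norm (f : R -> R) : measurable_fun [set: R] f ->
  measurable_fun [set: R] (fun x => (`|f x| `^ p)%:E).
Proof.
move=> mf; apply/measurable_EFinP.
by apply: (@measurableT_comp _ _ _ _ _ _ (fun x : R => x `^ p)) => //;
  exact: measurableT_comp.
Qed.

Lemma pint_le (f g : R -> R) :
  measurable_fun [set: R] f -> measurable_fun [set: R] g ->
  (forall x, `|f x| <= `|g x|) -> (pint p f <= pint p g)%E.
Proof.
move=> mf mg fg; apply: ge0_le_integral => //.
- exact: measurable_powR_norm.
- exact: measurable_powR_norm.
- by move=> x _; rewrite lee_fin ge0_ler_powR // ?nnegrE // ltW.
Qed.

Lemma inLp_norm (f : R -> R) : inLp p f -> inLp p (fun x => `|f x|).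
Proof.
move=> /(inLpP p1') [mf lf]; apply/(inLpP p1'); split.
  exact: measurableT_comp.
by apply: le_lt_trans lf; apply: pint_le => // [|x]; [exact: measurableT_comp|rewrite normr_id].
Qed.

Lemma nrm_norm (f : R -> R) : nrm p (fun x => `|f x|) = nrm p f.
Proof.
rewrite /nrm; congr fine; exact: (Lnorm_abse mu (EFin \o f) p%:E).
Qed.

Lemma limn_einf_le (u : (\bar R)^nat) (c : \bar R) :
  (forall n, u n <= c)%E -> (limn_einf u <= c)%E.
Proof.
move=> uc; rewrite limn_einf_lim; apply: lime_le; first exact: is_cvg_einfs.
apply: nearW => n; apply: le_trans (uc n).
by apply: ereal_inf_lbound; exists n => /=.
Qed.

Section RieszFischer.
Variable u : nat -> R -> R.
Hypothesis lu : forall n, inLp p (u n).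
Hypothesis uC : forall n, nrm p (fun x => u n.+1 x - u n x) <= 2^-1 ^+ n.

Let W n x : R := \sum_(k < n) `|u k.+1 x - u k x|.

Let mu_n n : measurable_fun [set: R] (u n). Proof. exact: (lu n).1. Qed.

Let lW n : inLp p (W n).
Proof.
apply: (@inLp_sum _ _ p1' _ _ (fun (k : 'I_n) x => `|u k.+1 x - u k x|)) => k.
by apply: inLp_norm; exact: inLpB.
Qed.

Let W_ge0 n x : 0 <= W n x. Proof. by rewrite sumr_ge0. Qed.

Let nW n : nrm p (W n) <= 2.
Proof.
apply: le_trans (_ : \sum_(k < n) 2^-1 ^+ k <= _).
  apply: le_trans (nrm_sum p1' _ _) _.
    by move=> k; apply: inLp_norm; exact: inLpB.
  by apply: ler_sum => k _; rewrite nrm_norm.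
have : \sum_(k < n) 2^-1 ^+ k = 2 - 2 * 2^-1 ^+ n :> R.
  elim: n => [|n IH]; first by rewrite big_ord0 expr0; lra.
  by rewrite big_ord_recr /= IH exprS; lra.
move=> ->; have : 0 <= 2^-1 ^+ n :> R by rewrite exprn_ge0.
lra.
Qed.

Let W_nd x : {homo (W ^~ x) : n m / (n <= m)%N >-> n <= m}.
Proof.
apply: homo_leq => //; first exact: le_trans.
by move=> n; rewrite /W big_ord_recr /= lerDl.
Qed.

Let Wp n x : \bar R := (W n x `^ p)%:E.

Let mWp n : measurable_fun [set: R] (Wp n).
Proof.
have := measurable_powR_norm (lW n).1; rewrite /Wp.
by under eq_fun do rewrite ger0_norm //.
Qed.

Let Wp_nd x : nondecreasing_seq (Wp ^~ x).
Proof.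
move=> n m nm; rewrite lee_fin ge0_ler_powR // ?nnegrE ?W_ge0 ?W_nd //.
exact: ltW.
Qed.

(** Monotone convergence bounds the integral of the limit of [W n ^ p] by [2 ^ p], so this limit is
    finite off a null set, and there the increments of [u] are absolutely summable. *)
Let good : exists2 E : set R, measurable E & mu (~` E) = 0%E /\
  forall x, E x -> exists B, forall n, W n x <= B.
Proof.
pose L x := limn (Wp ^~ x).
have cL x : Wp ^~ x @ \oo --> L x by exact: ereal_nondecreasing_is_cvgn.
have mL : measurable_fun [set: R] L.
  by apply: (@emeasurable_fun_cvg _ _ _ setT Wp L mWp) => x _; exact: cL.
have L0 x : (0 <= L x)%E.
  apply: lime_ge; first exact: cL.
  by apply: nearW => n; rewrite lee_fin powR_ge0.
have iL : (\int[mu]_x L x <= (2 `^ p)%:E)%E.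
  rewrite /L monotone_convergence //; last first.
    by move=> n x _; rewrite lee_fin powR_ge0.
  apply: lime_le.
    apply: ereal_nondecreasing_is_cvgn => n m nm; apply: ge0_le_integral => //.
    - by move=> x _; rewrite lee_fin powR_ge0.
    - exact: mWp.
    - exact: mWp.
    - by move=> x _; exact: Wp_nd.
  apply: nearW => n.
  have -> : (\int[mu]_x Wp n x = pint p (W n))%E.
    by apply: eq_integral => x _; rewrite /Wp ger0_norm.
  rewrite pintE // lee_fin ge0_ler_powR // ?nnegrE ?nrm_ge0 //.
  exact: ltW.
have : mu.-integrable [set: R] L.
  apply/integrableP; split=> //.
  under eq_integral do rewrite gee0_abs //.
  by apply: le_lt_trans iL _; rewrite ltry.
move=> /(integrable_ae measurableT) [N [mN N0 sN]].
exists (~` N); first exact: measurableC.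
rewrite setCK; split=> // x Nx.
have Lf : L x \is a fin_num.
  by apply: contrapT => h; apply: Nx; apply: sN => /= /(_ I).
exists (fine (L x) `^ p^-1) => n.
have WL : W n x `^ p <= fine (L x).
  rewrite -lee_fin fineK //; apply: lime_ge; first exact: cL.
  by exists n => // m /= nm; exact: Wp_nd.
have -> : W n x = (W n x `^ p) `^ p^-1.
  by rewrite -powRrM mulfV ?gt_eqF // powRr1 // W_ge0.
rewrite ge0_ler_powR // ?nnegrE ?powR_ge0 //; first by rewrite invr_ge0 ltW.
by apply: le_trans WL; rewrite powR_ge0.
Qed.

Let cvg_good x : (exists B, forall n, W n x <= B) -> cvgn (u ^~ x).
Proof.
move=> [B WB].
have cW : cvgn (W ^~ x).
  apply: nondecreasing_is_cvgn; first exact: W_nd.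
  by exists B => _ [n _ <-]; exact: WB.
have cS : cvgn (series (fun k => u k.+1 x - u k x)).
  apply: normed_cvg.
  have e : W ^~ x = [normed series (fun k => u k.+1 x - u k x)]%classic.
    by apply/funext => n; rewrite /W /= seriesEord.
  by rewrite e in cW.
have -> : u ^~ x = (fun n => u 0 x + series (fun k => u k.+1 x - u k x) n).
  apply/funext => n; rewrite /series /= telescope_sumr ?leq0n //.
  by rewrite addrC subrK.
by apply: is_cvgD => //; exact: is_cvg_cst.
Qed.

Let nrm_tail n k :
  nrm p (fun x => u (n + k)%N x - u n x) <= 2 * 2^-1 ^+ n - 2 * 2^-1 ^+ (n + k).
Proof.
elim: k => [|k IH].
  rewrite addn0 subrr (@eq_nrm _ _ _ (fun=> 0)) ?nrm0 // => x; exact: subrr.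
rewrite addnS; apply: le_trans (@nrm_triangle _ _ p1' (u (n + k)%N) _ _ _ _ _) _ => //.
have := lerD (uC (n + k)) IH; rewrite exprS; lra.
Qed.

(** Fatou's lemma passes the bound on [u (n + k) - u n], uniform in [k], to the limit. *)
Lemma riesz_fischer : exists2 v, inLp p v &
  forall n, nrm p (fun x => v x - u n x) <= 2 * 2^-1 ^+ n.
Proof.
have [E mE [E0 gE]] := good.
(* Cutting down to [E] makes the sequence converge at every point, so that the limit is measurable;
   only a null set is affected. *)
pose ue n x := u n x * \1_E x.
pose v x : R := limn (ue ^~ x).
have cue x : ue ^~ x @ \oo --> v x.
  rewrite /v /ue; have [xE|xE] := boolP (x \in E).
    rewrite indicE xE; under eq_fun do rewrite mulr1.
    by apply: cvg_good; apply: gE; exact: set_mem.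
  rewrite indicE (negbTE xE); under eq_fun do rewrite mulr0.
  exact: is_cvg_cst.
have mue n : measurable_fun [set: R] (ue n).
  by apply: measurable_funM => //; exact: measurable_indic.
have mv : measurable_fun [set: R] v.
  by apply: (@measurable_fun_cvg _ _ _ setT ue v mue) => x _; exact: cue.
have bound n : (pint p (fun x => (v x - u n x)%R) <= ((2 * 2^-1 ^+ n) `^ p)%:E)%E.
  have -> : pint p (fun x => v x - u n x) = pint p (fun x => v x - ue n x).
    apply: ge0_ae_eq_integral => //.
    - by apply: measurable_powR_norm; exact: measurable_funB.
    - by apply: measurable_powR_norm; exact: measurable_funB.
    exists (~` E); split => //; first exact: measurableC.
    move=> x /= h Ex; apply: h => _.
    by rewrite /ue indicE mem_set // mulr1.
  pose F k x := (`|ue (n + k)%N x - ue n x| `^ p)%:E.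
  have mF k : measurable_fun [set: R] (F k).
    by apply: measurable_powR_norm; exact: measurable_funB.
  have -> : pint p (fun x => v x - ue n x) = (\int[mu]_x limn_einf (F ^~ x))%E.
    apply: eq_integral => x _.
    have : F ^~ x @ \oo --> (`|v x - ue n x| `^ p)%:E.
      apply: cvg_EFin; first by apply: nearW.
      apply: cvg_powR => //.
      apply: cvg_norm; apply: cvgB; last exact: cvg_cst.
      under eq_fun do rewrite addnC.
      by move: (cue x); rewrite -(cvg_shiftn n).
    by move=> /cvg_limn_einf_sup [-> _].
  apply: le_trans (fatou mu measurableT mF _) _.
    by move=> k x _; rewrite lee_fin powR_ge0.
  apply: limn_einf_le => k.
  apply: (@le_trans _ _ (pint p (fun x => u (n + k)%N x - u n x))).
    apply: pint_le; [exact: measurable_funB|exact: measurable_funB|move=> x].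
    rewrite /ue -mulrBl normrM ler_piMr // indicE.
    by case: (_ \in _); rewrite ?normr1 ?normr0.
  rewrite pintE //; last exact: inLpB.
  rewrite lee_fin ge0_ler_powR // ?nnegrE ?nrm_ge0 //.
    exact: ltW.
  apply: le_trans (nrm_tail n k) _.
  by rewrite gerBl mulr_ge0 // exprn_ge0.
have lvu n : inLp p (fun x => v x - u n x).
  apply/(inLpP p1'); split; first exact: measurable_funB.
  by apply: le_lt_trans (bound n) _; rewrite ltry.
exists v => [|n].
  apply: eq_inLp (inLpD p1' (lvu 0) (lu 0)) => x; exact: subrK.
by apply: nrm_le_pint => //; rewrite mulr_ge0 // exprn_ge0.
Qed.

End RieszFischer.
End LpCompleteness.

(** * Criteria for unconditionality and for embedding L_p *)

Section UnconditionalCriterion.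
Variable R : realType.
Implicit Types (x y : R).

(** Every upper end [u m + K / (m + 1)] bounds all lower ends [u n - K / (n + 1)], so the supremum
    of the lower ends is a limit with the stated rate. *)
Lemma cauchy_inv_limit (u : nat -> R) (K : R) :
  (forall n m, `|u n - u m| <= K * (n.+1%:R^-1 + m.+1%:R^-1)) ->
  exists l, forall n, `|u n - l| <= K * n.+1%:R^-1.
Proof.
move=> uC.
pose A := range (fun n => u n - K * n.+1%:R^-1).
have uA m : ubound A (u m + K * m.+1%:R^-1).
  move=> _ [n _ <-]; have := uC n m; rewrite mulrDr ler_norml.
  by set a := K * n.+1%:R^-1; set b := K * m.+1%:R^-1 => /andP[_ h]; lra.
have sA : has_sup A by split; [exists (u 0 - K * 1%:R^-1); exists 0 | exists (u 0 + K * 1%:R^-1)].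
exists (sup A) => n; rewrite ler_norml.
have h1 := ge_sup sA.1 (uA n).
have h2 : u n - K * n.+1%:R^-1 <= sup A by apply: ub_le_sup; [exact: sA.2|exists n].
by move: h1 h2; set a := K * _ => h1 h2; apply/andP; split; lra.
Qed.

Lemma inv_nat_small (B e : R) : 0 < e -> exists m : nat, B * m.+1%:R^-1 < e.
Proof.
move=> e0.
have [B0|B0] := lerP B 0.
  by exists 0; apply: le_lt_trans e0; rewrite invr1 mulr1.
exists (Num.truncn (B / e)); rewrite ltr_pdivrMr ?ltr0n //.
rewrite -ltr_pdivrMl // mulrC.
by rewrite truncnS_gt.
Qed.

Lemma le_inv_natP x y (B : R) :
  (forall m : nat, x <= y + B * m.+1%:R^-1) -> x <= y.
Proof.
move=> h; apply/ler_addgt0Pr => e e0.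
have [m hm] := inv_nat_small B e0.
by apply: le_trans (h m) _; rewrite lerD2l ltW.
Qed.

Variable p : R.
Hypothesis p1 : 1 <= p.
Variables (f : R -> R) (Lam : set int).
Hypothesis lf : forall l, inLp p (translate f l).

Lemma inLp_lincomb F a : inLp p (lincomb f F a).
Proof.
by apply: (@inLp_sum _ _ p1 _ _ (fun l x => a l * translate f l x)) => l; exact: inLpZ.
Qed.

Lemma lincombB F a b x :
  lincomb f F a x - lincomb f F b x = lincomb f F (fun l => a l - b l) x.
Proof. by rewrite -sumrB; apply: eq_bigr => l _; rewrite mulrBl. Qed.

Lemma lincomb_extend F G a : uniq F -> uniq G -> {subset F <= G} ->
  lincomb f G (fun l => if l \in F then a l else 0) = lincomb f F a.
Proof.
move=> uF uG FG; apply/funext => x; rewrite /lincomb.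
rewrite (eq_bigr (fun l => if l \in F then a l * translate f l x else 0)); last first.
  by move=> l _; case: ifP; rewrite ?mul0r.
rewrite -big_mkcond -big_filter; apply: perm_big; apply: uniq_perm => //.
  exact: filter_uniq.
by move=> l; rewrite mem_filter; case: (boolP (l \in F)) => // /FG ->.
Qed.

Lemma finsubU F G : finsub Lam F -> finsub Lam G -> finsub Lam (undup (F ++ G)).
Proof.
move=> [uF sF] [uG sG]; split; first exact: undup_uniq.
by move=> l; rewrite mem_undup mem_cat => /orP[/sF|/sG].
Qed.

Lemma nrm_lincomb_le F a b : nrm p (lincomb f F (fun l => a l - b l)) <=
  \sum_(l <- F) `|a l - b l| * nrm p (translate f l).
Proof.
apply: le_trans (nrm_sum p1 _ _) _; first by move=> l; exact: inLpZ.
by apply: ler_sum => l _; rewrite nrmZ.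
Qed.

Variables (C : R) (K : int -> R).
Hypothesis C0 : 0 <= C.
Hypothesis K0 : forall l, 0 <= K l.
Hypothesis suppress : forall a F G, finsub Lam F -> finsub Lam G ->
  {subset F <= G} -> nrm p (lincomb f F a) <= C * nrm p (lincomb f G a).
Hypothesis coord : forall a F l, finsub Lam F -> l \in F ->
  `|a l| <= K l * nrm p (lincomb f F a).

Lemma uncond_sum_unique g a b : inLp p g -> uncond_sum_to p f Lam a g ->
  uncond_sum_to p f Lam b g -> forall l, Lam l -> a l = b l.
Proof.
move=> lg ga gb l Ll; apply/eqP; rewrite -subr_eq0 -normr_le0.
apply/ler_addgt0Pr => e e0; rewrite add0r.
(* The added 1 covers the case [K l = 0]. *)
pose d := e / (2 * (K l + 1)).
have K1 : 0 < K l + 1 by rewrite ltr_pwDr.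
have d0 : 0 < d by rewrite divr_gt0 // mulr_gt0.
have [Fa [fFa ha]] := ga d d0.
have [Fb [fFb hb]] := gb d d0.
have fl : finsub Lam [:: l].
  by split => // m; rewrite inE => /eqP ->; exact: mem_set.
pose F := undup (undup (Fa ++ Fb) ++ [:: l]).
have fF : finsub Lam F by apply: finsubU fl; exact: finsubU.
have lF : l \in F by rewrite mem_undup mem_cat inE eqxx orbT.
have sa : {subset Fa <= F} by move=> m mF; rewrite !(mem_undup, mem_cat) mF.
have sb : {subset Fb <= F} by move=> m mF; rewrite !(mem_undup, mem_cat) mF orbT.
have := ha F fF sa; have := hb F fF sb.
have la := inLp_lincomb F a; have lb := inLp_lincomb F b.
rewrite !Lpnorm_lt //; [|exact: inLpB|exact: inLpB] => h1 h2.
have h3 : nrm p (lincomb f F (fun l => a l - b l)) <= 2 * d.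
  rewrite (@eq_nrm _ _ _ (fun x => lincomb f F a x - lincomb f F b x)); last first.
    by move=> x; rewrite lincombB.
  apply: le_trans (nrm_triangle p1 la lg lb) _.
  by rewrite (nrmN p1 la lg); lra.
apply: le_trans (coord (fun l => a l - b l) fF lF) _.
apply: le_trans (_ : (K l + 1) * (2 * d) <= _).
  by apply: ler_pM => //; rewrite ?nrm_ge0 // lerDl.
by rewrite le_eqVlt; apply/orP; left; apply/eqP; rewrite /d; field; rewrite gt_eqF.
Qed.

(** By [coord] the coefficients of better and better approximants converge. By [suppress] the errors
    on a finite set [G] are bounded independently of [G], so the limit coefficients serve the whole
    net of finite sets. *)
Lemma uncond_sum_exists g : Xp p f Lam g -> exists a, uncond_sum_to p f Lam a g.
Proof.
move=> [lg gX].
have n0 n : 0 < n.+1%:R^-1 :> R by rewrite invr_gt0.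
have /choice[s hs] : forall n, exists Fa : seq int * (int -> R),
    finsub Lam Fa.1 /\ nrm p (fun x => g x - lincomb f Fa.1 Fa.2 x) < n.+1%:R^-1.
  move=> n; have [F [a [fF h]]] := gX _ (n0 n); exists (F, a); split=> //.
  by move: h; rewrite Lpnorm_lt //; exact/inLpB/inLp_lincomb.
pose F n := (s n).1.
have fF n : finsub Lam (F n) by exact: (hs n).1.
(* Padding by 0 allows approximants with different index sets to be compared on a common
   superset. *)
pose a n l := if l \in F n then (s n).2 l else 0.
have close n G : finsub Lam G -> {subset F n <= G} ->
    nrm p (fun x => g x - lincomb f G (a n) x) < n.+1%:R^-1.
  by move=> fG FG; rewrite (lincomb_extend _ (fF n).1 fG.1 FG); exact: (hs n).2.
have diff n m G : finsub Lam G -> nrm p (lincomb f G (fun l => a n l - a m l)) <=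
    C * (n.+1%:R^-1 + m.+1%:R^-1).
  move=> fG; pose H := undup (G ++ undup (F n ++ F m)).
  have fH : finsub Lam H by apply: finsubU => //; exact: finsubU.
  have sG : {subset G <= H} by move=> l lG; rewrite !(mem_undup, mem_cat) lG.
  have sn : {subset F n <= H} by move=> l lG; rewrite !(mem_undup, mem_cat) lG orbT.
  have sm : {subset F m <= H} by move=> l lG; rewrite !(mem_undup, mem_cat) lG !orbT.
  apply: le_trans (suppress _ fG fH sG) _; rewrite ler_wpM2l //.
  rewrite (@eq_nrm _ _ _ (fun x => lincomb f H (a n) x - lincomb f H (a m) x)); last first.
    by move=> x; rewrite lincombB.
  have ln := inLp_lincomb H (a n); have lm := inLp_lincomb H (a m).
  apply: le_trans (nrm_triangle p1 ln lg lm) _.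
  by rewrite (nrmN p1 ln lg); apply: ltW; apply: ltrD; exact: close.
have lim l : exists b, Lam l -> forall n, `|a n l - b| <= K l * C * n.+1%:R^-1.
  have [Ll|nLl] := pselect (Lam l); last by exists 0.
  have fl : finsub Lam [:: l].
    by split => // m; rewrite inE => /eqP ->; exact: mem_set.
  have [n m|b hb] := @cauchy_inv_limit (a ^~ l) (K l * C); last by exists b.
  rewrite -mulrA.
  apply: le_trans (coord (fun l => a n l - a m l) fl (mem_head _ _)) _.
  by rewrite ler_wpM2l //; exact: diff.
have [b hb] := choice lim.
exists b => e e0.
have [n hn] := inv_nat_small (1 + C) e0.
exists (F n); split=> // G fG FG.
have ln := inLp_lincomb G (a n); have lb := inLp_lincomb G b.
rewrite Lpnorm_lt //; last exact: inLpB.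
apply: le_lt_trans (nrm_triangle p1 lg ln lb) _.
apply: lt_le_trans (ltW hn); rewrite mulrDl mul1r.
apply: ltr_leD; first exact: close.
rewrite (@eq_nrm _ _ _ (lincomb f G (fun l => a n l - b l))); last first.
  by move=> x; rewrite lincombB.
(* For fixed [G] the coefficients [a m] tend to [b] as [m] grows, so [b] may be replaced by [a m] at
   a cost that vanishes in the limit; only this cost depends on [G]. *)
apply: (@le_inv_natP _ _ (C + \sum_(l <- G) K l * C * nrm p (translate f l))) => m.
rewrite (@eq_nrm _ _ _ (fun x => lincomb f G (fun l => a n l - a m l) x +
    lincomb f G (fun l => a m l - b l) x)); last first.
  by move=> x; rewrite /lincomb -big_split; apply: eq_bigr => l _ /=; ring.
apply: le_trans (nrmD p1 (inLp_lincomb _ _) (inLp_lincomb _ _)) _.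
rewrite mulrDl addrA -mulrDr; apply: lerD; first exact: diff.
apply: le_trans (nrm_lincomb_le _ _ _) _.
rewrite mulr_suml big_seq [leRHS]big_seq; apply: ler_sum => l lG.
rewrite -mulrA [nrm p _ * _]mulrC mulrA ler_wpM2r ?nrm_ge0 //.
by apply: hb; have := fG.2 _ lG; rewrite inE.
Qed.

Lemma uncond_basicP : uncond_basic p f Lam.
Proof.
move=> g gX; split; first exact: uncond_sum_exists.
by move=> a b; exact: (uncond_sum_unique gX.1).
Qed.

End UnconditionalCriterion.

(** * Extension of an isomorphic embedding from a dense span *)

Section EmbeddingExtension.
Variable R : realType.
Variable p : R.
Hypothesis p1 : 1 < p.

Let p1' : 1 <= p. Proof. exact: ltW. Qed.

Definition comb (h : nat -> R -> R) (I : nat) (c : nat -> R) : R -> R :=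
  fun x => \sum_(i < I) c i * h i x.

Lemma inLp_comb h I c : (forall i, inLp p (h i)) -> inLp p (comb h I c).
Proof.
move=> lh.
by apply: (@inLp_sum _ _ p1' _ _ (fun (i : 'I_I) x => c i * h i x)) => i; exact: inLpZ.
Qed.

Definition cutoff (I : nat) (c : nat -> R) (i : nat) : R := if (i < I)%N then c i else 0.

Lemma comb_cutoff h I J c : (I <= J)%N -> comb h J (cutoff I c) = comb h I c.
Proof.
move=> IJ; apply/funext => x; rewrite /comb /cutoff.
rewrite (big_ord_widen J (fun i => c i * h i x) IJ) [RHS]big_mkcond.
by apply: eq_bigr => i _; case: ifP; rewrite ?mul0r.
Qed.

Lemma comb_linear h I c d k x :
  comb h I (fun i => k * c i + d i) x = k * comb h I c x + comb h I d x.
Proof.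
rewrite /comb mulr_sumr -big_split; apply: eq_bigr => i _ /=; ring.
Qed.

Lemma comb_common h I J c d : exists M c' d',
  comb h I c = comb h M c' /\ comb h J d = comb h M d'.
Proof.
exists (maxn I J), (cutoff I c), (cutoff J d).
by rewrite !comb_cutoff ?leq_maxl ?leq_maxr.
Qed.

Variables (h w : nat -> R -> R) (X : set (R -> R)) (A B : R).
Hypothesis lh : forall i, inLp p (h i).
Hypothesis lw : forall i, inLp p (w i).
Hypothesis A0 : 0 < A.
Hypothesis B0 : 0 < B.
Hypothesis lower : forall I c, A * nrm p (comb h I c) <= nrm p (comb w I c).
Hypothesis upper : forall I c, nrm p (comb w I c) <= B * nrm p (comb h I c).
Hypothesis dense : forall g, inLp p g -> forall e, 0 < e ->
  exists I c, nrm p (fun x => g x - comb h I c x) < e.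
Hypothesis closedX : forall v, inLp p v -> (forall e, 0 < e ->
  exists I c, nrm p (fun x => v x - comb w I c x) < e) -> X v.

(** The closed graph of the map sending [comb h I c] to [comb w I c]. The embedding is chosen from
    it function by function, so its linearity and bounds have to be read off the graph. *)
Let matched g v := forall e, 0 < e -> exists I c,
  nrm p (fun x => g x - comb h I c x) < e /\ nrm p (fun x => v x - comb w I c x) < e.

Let upperB I c J d : nrm p (fun x => comb w I c x - comb w J d x) <=
  B * nrm p (fun x => comb h I c x - comb h J d x).
Proof.
pose M := maxn I J; pose e i := -1 * cutoff J d i + cutoff I c i.
have E k : (fun x => comb k I c x - comb k J d x) = comb k M e.
  apply/funext => x; rewrite /e comb_linear !comb_cutoff ?leq_maxl ?leq_maxr //.
  by rewrite mulN1r addrC.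
by rewrite !E; exact: upper.
Qed.

Let matched_exists g : inLp p g -> exists v, inLp p v /\ matched g v.
Proof.
move=> lg.
(* Consecutive approximants of [g] differ by at most [2 * d n], hence their images by at most
   [2^-1 ^+ n], as [riesz_fischer] requires. *)
pose d n : R := 2^-1 ^+ n / (2 * B).
have d0 n : 0 < d n by rewrite divr_gt0 ?exprn_gt0 ?mulr_gt0.
have /choice[s hs] : forall n, exists Ic : nat * (nat -> R),
    nrm p (fun x => g x - comb h Ic.1 Ic.2 x) < d n.
  by move=> n; have [I [c hc]] := dense lg (d0 n); exists (I, c).
pose u n := comb w (s n).1 (s n).2.
have lu n : inLp p (u n) by exact: inLp_comb.
have uC n : nrm p (fun x => u n.+1 x - u n x) <= 2^-1 ^+ n.
  apply: le_trans (upperB _ _ _ _) _.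
  have l1 n' : inLp p (comb h (s n').1 (s n').2) by exact: inLp_comb.
  have := nrm_triangle p1' (l1 n.+1) lg (l1 n).
  rewrite (nrmN p1' (l1 n.+1) lg) => tr.
  have dd : d n.+1 <= d n.
    rewrite /d ler_pM2r ?invr_gt0 ?mulr_gt0 // exprS ler_piMl ?exprn_ge0 //.
    by rewrite invf_le1 ?ler1n.
  have k := ltW (hs n.+1); have k' := ltW (hs n).
  apply: le_trans (_ : B * (d n + d n) <= _).
    by apply: (ler_wpM2l (ltW B0)); lra.
  by rewrite le_eqVlt; apply/orP; left; apply/eqP; rewrite /d; field; rewrite gt_eqF.
have [v lv hv] := riesz_fischer p1 lu uC.
exists v; split=> // e e0.
have [m hm] : exists m, 2 * 2^-1 ^+ m < e /\ d m < e.
  have e1 : 0 < Num.min (e / 2) (e * (2 * B)) by rewrite lt_min !(divr_gt0, mulr_gt0).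
  have : (fun n => 2^-1 ^+ n : R) @ \oo --> 0.
    by apply: cvg_expr; rewrite ger0_norm // invf_lt1 // ltr1n.
  move=> /cvgr0Pnorm_lt /(_ _ e1) [m _ hm]; exists m.
  have := hm m (leqnn m); rewrite ger0_norm ?exprn_ge0 // lt_min => /andP[h1 h2].
  by split; [lra|rewrite /d ltr_pdivrMr ?mulr_gt0].
exists (s m).1, (s m).2; split; first exact: lt_trans (hs m) hm.2.
exact: le_lt_trans (hv m) hm.1.
Qed.

Let matched_linear g g' k v v' v'' : inLp p g -> inLp p g' -> inLp p v ->
  inLp p v' -> inLp p v'' -> matched g v -> matched g' v' ->
  matched (fun y => k * g y + g' y) v'' ->
  nrm p (fun x => v'' x - (k * v x + v' x)) = 0.
Proof.
move=> lg lg' lv lv' lv'' m m' m''; apply/eqP; rewrite eq_le nrm_ge0 andbT.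
have k0 : 0 <= `|k| by [].
have B1 : 0 < B + 1 by rewrite addr_gt0.
have k2 : 0 < 2 + `|k| by rewrite ltr_pwDl.
have M0 : 0 < (B + 1) * (2 + `|k|) by rewrite mulr_gt0.
apply/ler_addgt0Pr => e e0; rewrite add0r.
(* The approximation errors add up to [(2 + |k|) * d] among the functions and again among the
   images; the first sum reaches the images multiplied by [B]. *)
pose d := e / ((B + 1) * (2 + `|k|)).
have d0 : 0 < d by rewrite divr_gt0.
have [I [c [hc wc]]] := m _ d0.
have [I' [c' [hc' wc']]] := m' _ d0.
have [I'' [c'' [hc'' wc'']]] := m'' _ d0.
pose M := maxn I I'; pose b i := k * cutoff I c i + cutoff I' c' i.
have bE q x : comb q M b x = k * comb q I c x + comb q I' c' x.
  by rewrite comb_linear !comb_cutoff ?leq_maxl ?leq_maxr.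
have est q (g1 g2 : R -> R) : (forall i, inLp p (q i)) -> inLp p g1 -> inLp p g2 ->
    nrm p (fun x => g1 x - comb q I c x) < d ->
    nrm p (fun x => g2 x - comb q I' c' x) < d ->
    nrm p (fun x => comb q M b x - (k * g1 x + g2 x)) <= (1 + `|k|) * d.
  move=> lq l1 l2 h1 h2.
  have L1 := inLp_comb I c lq; have L2 := inLp_comb I' c' lq.
  rewrite (@eq_nrm _ _ _ (fun x => - k * (g1 x - comb q I c x) +
    (comb q I' c' x - g2 x))); last by move=> x; rewrite bE; ring.
  apply: le_trans (nrmD p1' (inLpZ p1' _ (inLpB p1' l1 L1)) (inLpB p1' L2 l2)) _.
  rewrite nrmZ // ?normrN; last exact: inLpB.
  rewrite (nrmN p1' L2 l2) (addrC 1) mulrDl mul1r.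
  exact: lerD (ler_wpM2l k0 (ltW h1)) (ltW h2).
have lL : inLp p (fun x => k * v x + v' x) by apply: inLpD => //; exact: inLpZ.
have lG : inLp p (fun x => k * g x + g' x) by apply: inLpD => //; exact: inLpZ.
have L1 := inLp_comb I'' c'' lw; have L2 := inLp_comb M b lw.
have H1 := inLp_comb I'' c'' lh; have H2 := inLp_comb M b lh.
have t1 := nrm_triangle p1' lv'' L1 lL.
have t2 := nrm_triangle p1' L1 L2 lL.
have t3 := upperB I'' c'' M b.
have t4 := nrm_triangle p1' H1 lG H2.
have e1 := est _ _ _ lw lv lv' wc wc'.
have e2 := est _ _ _ lh lg lg' hc hc'.
rewrite (nrmN p1' H1 lG) (nrmN p1' lG H2) in t4.
have t5 : nrm p (fun x => comb h I'' c'' x - comb h M b x) <= (2 + `|k|) * d.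
  by move: hc''; lra.
have t6 := ler_wpM2l (ltW B0) t5.
have -> : e = (2 + `|k|) * d + B * ((2 + `|k|) * d).
  by rewrite /d; field; rewrite !gt_eqF.
lra.
Qed.

Lemma contains_Lp_copyP : contains_Lp_copy p X.
Proof.
have ex g : exists v, inLp p g -> inLp p v /\ matched g v.
  have [lg|nlg] := pselect (inLp p g); last by exists g.
  by have [v hv] := matched_exists lg; exists v.
have [T hT] := choice ex.
have lT g (lg : inLp p g) : inLp p (T g) by exact: (hT g lg).1.
have mT g (lg : inLp p g) : matched g (T g) by exact: (hT g lg).2.
exists T, A, B; split=> //; split=> //; split; [|split].
- move=> g lg; apply: closedX; first exact: lT.
  move=> e e0; have [I [c [_ hc]]] := mT g lg e e0.
  by exists I, c.
- move=> g g' k lg lg'.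
  have lG : inLp p (fun x => k * g x + g' x) by apply: inLpD => //; exact: inLpZ.
  rewrite nrmE //; last first.
    by apply: inLpB => //; [exact: lT|apply: inLpD => //; [exact/inLpZ/lT|exact: lT]].
  congr (_%:E); apply: (matched_linear lg lg' _ _ _ (mT g lg) (mT g' lg') (mT _ lG));
  exact: lT.
- move=> g lg; rewrite !nrmE //; last exact: lT.
  rewrite -!EFinM !lee_fin; split; apply/ler_addgt0Pr => e e0.
  + pose d := e / (A + 1).
    have A1 : 0 < A + 1 by rewrite addr_gt0.
    have d0 : 0 < d by rewrite divr_gt0.
    have [I [c [hc wc]]] := mT g lg d d0.
    have t1 := nrm_leB p1' lg (inLp_comb I c lh).
    have t2 := nrm_leB p1' (inLp_comb I c lw) (lT g lg).
    rewrite (nrmN p1' (inLp_comb I c lw) (lT g lg)) in t2.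
    have t3 := lower I c.
    have -> : e = A * d + d by rewrite /d; field; rewrite gt_eqF.
    have t4 : nrm p g <= nrm p (comb h I c) + d by lra.
    have := ler_wpM2l (ltW A0) t4; rewrite mulrDr; lra.
  + pose d := e / (B + 1).
    have B1 : 0 < B + 1 by rewrite addr_gt0.
    have d0 : 0 < d by rewrite divr_gt0.
    have [I [c [hc wc]]] := mT g lg d d0.
    have t1 := nrm_leB p1' (lT g lg) (inLp_comb I c lw).
    have t2 := nrm_leB p1' (inLp_comb I c lh) lg.
    rewrite (nrmN p1' (inLp_comb I c lh) lg) in t2.
    have t3 := upper I c.
    have -> : e = B * d + d by rewrite /d; field; rewrite gt_eqF.
    have t4 : nrm p (comb h I c) <= nrm p g + d by lra.
    have := ler_wpM2l (ltW B0) t4; rewrite mulrDr; lra.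
Qed.

End EmbeddingExtension.

(** * Dyadic step functions on unit columns *)

Section DyadicCells.
Variable R : realType.
Implicit Types (x y : R).

Local Notation mu := (@lebesgue_measure R).

(** The number, in the numbering of [dmart], of the level-[n] dyadic interval containing
    [y >= 0]. *)
Definition lev n y : nat := Num.truncn (2 ^+ n * y).

Lemma lev_half n y : 0 <= y -> lev n y = (lev n.+1 y)./2.
Proof.
move=> y0; rewrite /lev; set Y := 2 ^+ n * y.
have Y0 : 0 <= Y by rewrite mulr_ge0 ?exprn_ge0.
have -> : 2 ^+ n.+1 * y = 2 * Y by rewrite exprS mulrA.
set T := Num.truncn (2 * Y); apply: truncn_def.
have /andP[h1 h2] : T%:R <= 2 * Y < T.+1%:R by apply: truncn_itv; rewrite mulr_ge0.
have TE : T%:R = (odd T)%:R + 2 * (T./2)%:R :> R.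
  by rewrite -natrM -natrD mul2n odd_double_half.
have o1 : 0 <= ((odd T)%:R : R) <= 1 by case: (odd T); rewrite ?ler01 ?lexx.
move: h1 h2; rewrite -[T.+1%:R]natr1 TE => h1 h2.
have /andP[d1 d2] := o1.
rewrite -[_.+1%:R]natr1.
by apply/andP; split; lra.
Qed.

Lemma lev_div n m y : 0 <= y -> (n <= m)%N -> lev n y = (lev m y %/ 2 ^ (m - n))%N.
Proof.
move=> y0 nm; rewrite -{1}(subnKC nm); elim: (m - n)%N => [|k IH].
  by rewrite addn0 expn0 divn1.
by rewrite addnS IH lev_half // -divn2 -divnMA -expnS.
Qed.

Lemma lev0 j y : j%:R <= y < j.+1%:R -> lev 0 y = j.
Proof. by rewrite /lev expr0 mul1r; exact: truncn_def. Qed.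

Variable M : nat -> int.
Hypothesis M_inj : injective M.

(* The unit column [M j, M j + 1) is sent to [j, j + 1), and everything outside
   the columns to -1. *)
Definition unf x : R :=
  if pselect (exists j, M j = Num.floor x) is left H
  then (projT1 (cid H))%:R + (x - (Num.floor x)%:~R) else -1.

Lemma unf_in x j : M j = Num.floor x -> unf x = j%:R + (x - (Num.floor x)%:~R).
Proof.
move=> Mj; rewrite /unf; case: pselect => [H|]; last by case; exists j.
by case: (cid H) => i /= Mi; congr (_%:R + _); apply: M_inj; rewrite Mi.
Qed.

Lemma unf_bounds x j : M j = Num.floor x -> j%:R <= unf x < j.+1%:R.
Proof.
move=> Mj; rewrite (unf_in Mj) -natr1.
have := floor_itv x; rewrite intrD => /andP[h1 h2].
by apply/andP; split; lra.
Qed.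

Lemma unf_ge0P x : reflect (exists j, M j = Num.floor x) (0 <= unf x).
Proof.
apply: (iffP idP) => [|[j Mj]]; last first.
  by have /andP[+ _] := unf_bounds Mj; apply: le_trans.
by rewrite /unf; case: pselect => // _; rewrite ler0N1.
Qed.

(** Written as an explicit interval, which gives measurability and measure at once; [cellP] links it
    to [unf] and [lev]. *)
Definition cell N t : set R :=
  [set` `[(M (t %/ 2 ^ N)%N)%:~R + (t %% 2 ^ N)%:R / 2 ^+ N,
     (M (t %/ 2 ^ N)%N)%:~R + (t %% 2 ^ N).+1%:R / 2 ^+ N[].

Lemma cellP N t x : cell N t x <-> 0 <= unf x /\ lev N (unf x) = t.
Proof.
have P0 : 0 < 2 ^+ N :> R by rewrite exprn_gt0.
have PN : (0 < 2 ^ N)%N by rewrite expn_gt0.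
have tE : t%:R = (t %/ 2 ^ N)%:R * 2 ^+ N + (t %% 2 ^ N)%:R :> R.
  by rewrite {1}(divn_eq t (2 ^ N)) natrD natrM natrX.
have tm : (t %% 2 ^ N).+1%:R <= 2 ^+ N :> R by rewrite -natrX ler_nat ltn_pmod.
rewrite /cell /= in_itv /=.
set a := (t %/ 2 ^ N)%N; set b := (t %% 2 ^ N)%N.
rewrite -/a -/b in tE tm.
split=> [/andP[h1 h2]|[h0 ht]].
- have f : Num.floor x = M a.
    apply: floor_def; rewrite intrD; apply/andP; split.
      by apply: le_trans h1; rewrite lerDl divr_ge0 // ltW.
    by apply: lt_le_trans h2 _; rewrite lerD2l ler_pdivrMr // mul1r.
  have u0 : 0 <= unf x by apply/unf_ge0P; exists a.
  split=> //; apply: truncn_def; rewrite (unf_in (esym f)) f mulrDr -[t.+1%:R]natr1 tE.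
  have h1' : b%:R <= 2 ^+ N * (x - (M a)%:~R).
    by rewrite mulrC -ler_pdivrMr //; lra.
  have h2' : 2 ^+ N * (x - (M a)%:~R) < b.+1%:R.
    by rewrite mulrC -ltr_pdivlMr //; lra.
  rewrite -[b.+1%:R]natr1 in h2'; rewrite [a%:R * _]mulrC.
  by apply/andP; split; lra.
- have /unf_ge0P [j Mj] := h0.
  have ja : a = j.
    by rewrite -(lev0 (unf_bounds Mj)) (lev_div h0 (leq0n N)) subn0 ht.
  have /andP[] : t%:R <= 2 ^+ N * unf x < t.+1%:R.
    by rewrite -ht; apply: truncn_itv; rewrite mulr_ge0 // ltW.
  rewrite -[t.+1%:R]natr1 (unf_in Mj) -Mj tE ja mulrDr [j%:R * _]mulrC => h1 h2.
  have h1' : b%:R <= 2 ^+ N * (x - (M j)%:~R) by lra.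
  have h2' : 2 ^+ N * (x - (M j)%:~R) < b.+1%:R by rewrite -[b.+1%:R]natr1; lra.
  move: h1' h2'; rewrite mulrC -ler_pdivrMr // -ltr_pdivlMr // => h1' h2'.
  by apply/andP; split; lra.
Qed.

Lemma measurable_cell N t : measurable (cell N t).
Proof. exact: measurable_itv. Qed.

Lemma mu_cell N t : mu (cell N t) = (2^-1 ^+ N)%:E.
Proof.
have P0 : 0 < 2 ^+ N :> R by rewrite exprn_gt0.
rewrite /cell lebesgue_measure_itv /= lte_fin ltrD2l ltr_pM2r ?invr_gt0 //.
rewrite ltr_nat ltnSn -EFinB; congr (_%:E).
by rewrite -natr1 exprVn; field; rewrite gt_eqF.
Qed.

Definition stepf N (v : nat -> R) x : R :=
  if 0 <= unf x then v (lev N (unf x)) else 0.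

Lemma stepf_cell N v t x : cell N t x -> stepf N v x = v t.
Proof. by move=> /cellP [u0 ht]; rewrite /stepf u0 ht. Qed.

Lemma stepf_out N v x : unf x < 0 -> stepf N v x = 0.
Proof. by move=> u0; rewrite /stepf leNgt u0. Qed.

Lemma stepf_comp N v (F : R -> R) x : F 0 = 0 -> F (stepf N v x) = stepf N (F \o v) x.
Proof. by rewrite /stepf; case: ifP. Qed.

Lemma stepf_sum N K v x : (forall t, (K <= t)%N -> v t = 0) ->
  stepf N v x = \sum_(t < K) v t * \1_(cell N t) x.
Proof.
move=> vK; have [u0|u0] := lerP 0 (unf x); last first.
  rewrite stepf_out // big1 // => t _; rewrite indicE memNset ?mulr0 //.
  by move=> /cellP[]; rewrite leNgt u0.
set s := lev N (unf x).
have E t : \1_(cell N t) x = (t == s)%:R :> R.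
  rewrite indicE; congr (_%:R); congr nat_of_bool; apply/idP/eqP.
    by move=> /set_mem /cellP[].
  by move=> ->; apply/mem_set/cellP.
under eq_bigr do rewrite E.
rewrite /stepf u0 -/s; have [sK|Ks] := ltnP s K.
  rewrite (bigD1 (Ordinal sK)) //= eqxx mulr1 big1 ?addr0 // => t.
  by rewrite -val_eqE /= => /negbTE ->; rewrite mulr0.
rewrite vK // big1 // => t _; case: eqP => [ts|]; last by rewrite mulr0.
by move: (ltn_ord t); rewrite ts ltnNge Ks.
Qed.

Lemma stepf_refine N n v x : (N <= n)%N ->
  stepf N v x = stepf n (fun t => v (t %/ 2 ^ (n - N))%N) x.
Proof. by move=> Nn; rewrite /stepf; case: ifP => // u0; rewrite (lev_div u0 Nn). Qed.

Lemma measurable_stepf N K v : (forall t, (K <= t)%N -> v t = 0) ->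
  measurable_fun [set: R] (stepf N v).
Proof.
move=> vK; rewrite (_ : stepf N v = fun x => \sum_(t < K) v t * \1_(cell N t) x).
  apply: measurable_sum => t; apply: measurable_funM => //.
  by apply: measurable_indic; exact: measurable_cell.
by apply/funext => x; exact: stepf_sum.
Qed.

Lemma integral_stepf N K v : (forall t, (K <= t)%N -> v t = 0) ->
  (forall t, 0 <= v t) ->
  (\int[mu]_x (stepf N v x)%:E = (2^-1 ^+ N * \sum_(t < K) v t)%:E)%E.
Proof.
move=> vK v0.
under eq_integral do rewrite (stepf_sum _ _ vK) -sumEFin.
rewrite ge0_integral_sum //; last 2 first.
- move=> t; apply/measurable_EFinP; apply: measurable_funM => //.
  by apply: measurable_indic; exact: measurable_cell.
- by move=> t x _; rewrite lee_fin mulr_ge0.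
rewrite mulr_sumr -sumEFin; apply: eq_bigr => t _.
under eq_integral do rewrite EFinM.
rewrite ge0_integralZl //; last 2 first.
- apply/measurable_EFinP; apply: measurable_indic; exact: measurable_cell.
- by rewrite lee_fin.
rewrite integral_indic //; last exact: measurable_cell.
rewrite setIT; transitivity ((v t)%:E * (2^-1 ^+ N)%:E)%E.
  by congr (_ * _)%E; exact: mu_cell.
by rewrite -EFinM mulrC.
Qed.

Lemma pint_stepf (p : R) N K v : 0 < p -> (forall t, (K <= t)%N -> v t = 0) ->
  pint p (stepf N v) = (2^-1 ^+ N * \sum_(t < K) `|v t| `^ p)%:E.
Proof.
move=> p0 vK; rewrite -(@integral_stepf N K (fun t => `|v t| `^ p)); last 2 first.
- by move=> t Kt; rewrite vK // normr0 powR0 // gt_eqF.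
- by move=> t; exact: powR_ge0.
apply: eq_integral => x _; congr (_%:E).
by rewrite (@stepf_comp _ _ (fun z => `|z| `^ p)) // normr0 powR0 // gt_eqF.
Qed.

End DyadicCells.

(** * Density of dyadic step functions *)

Section LpDensity.
Variable R : realType.
Variable p : R.
Hypothesis p1 : 1 < p.
Implicit Types (f g G : R -> R).

Local Notation mu := (@lebesgue_measure R).

Let p1' : 1 <= p. Proof. exact: ltW. Qed.
Let p0 : 0 < p. Proof. exact: lt_trans p1. Qed.

Lemma inLp_dominated g G : measurable_fun [set: R] g -> inLp p G ->
  (forall x, `|g x| <= `|G x|) -> inLp p g.
Proof.
move=> mg lG gG; have [mG pG] := (inLpP p1' G).1 lG.
apply: (inLpP p1' g).2; split; first exact: mg.
by apply: le_lt_trans pG; exact: pint_le.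
Qed.

Lemma Lp_dominated_cvg (phi : nat -> R -> R) g G :
  (forall n, measurable_fun [set: R] (phi n)) -> inLp p G ->
  (forall n x, `|phi n x| <= `|G x|) ->
  (forall x, phi ^~ x @ \oo --> g x) ->
  inLp p g /\ forall e, 0 < e -> exists n, nrm p (fun x => g x - phi n x) < e.
Proof.
move=> mphi lG phiG phig.
have mg : measurable_fun [set: R] g.
  by apply: (@measurable_fun_cvg _ _ _ setT phi g mphi) => x _; exact: phig.
have gG x : `|g x| <= `|G x|.
  have cn : (fun n => `|phi n x|) @ \oo --> `|g x| by apply: cvg_norm; exact: phig.
  rewrite -(cvg_lim _ cn) //; apply: limr_le; first by apply/cvg_ex; exists `|g x|.
  by apply: nearW => n; exact: phiG.
have lg : inLp p g by exact: inLp_dominated gG.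
split=> // e e0.
have l2G : inLp p (fun x => 2 * G x) by exact: inLpZ.
have mB n : measurable_fun [set: R] (fun x => g x - phi n x) by exact: measurable_funB.
have bound n x : `|g x - phi n x| <= `|2 * G x|.
  apply: le_trans (ler_normB _ _) _.
  by rewrite normrM ger0_norm // mulr_natl mulr2n lerD.
have cv : (fun n => pint p (fun x => g x - phi n x)) @ \oo --> 0%E.
  have H1 : {ae mu, forall x, [set: R] x ->
      (fun n => (`|g x - phi n x| `^ p)%:E) @ \oo --> 0%E}.
    apply/aeW => x _.
    have hu : (fun n => `|g x - phi n x|) @ \oo --> (0 : R).
      suff : (fun n => `|g x - phi n x|) @ \oo --> `|g x - g x|.
        by rewrite subrr normr0.
      by apply: cvg_norm; apply: cvgB => //; exact: cvg_cst.
    have := cvg_powR p1 (fun n => normr_ge0 _) (lexx 0) hu.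
    rewrite powR0 ?gt_eqF // => hv.
    by apply: cvg_EFin; [exact: nearW|exact: hv].
  have H2 : mu.-integrable [set: R] (fun x => (`|2 * G x| `^ p)%:E).
    apply/integrableP; split; first exact: measurable_powR_norm l2G.1.
    have [_ l] := (inLpP p1' _).1 l2G.
    apply: le_lt_trans l; rewrite le_eqVlt; apply/orP; left; apply/eqP.
    by apply: eq_integral => x _; rewrite gee0_abs ?lee_fin ?powR_ge0.
  have H3 : {ae mu, forall x n, [set: R] x ->
      (`|(`|g x - phi n x| `^ p)%:E| <= (`|2 * G x| `^ p)%:E)%E}.
    apply/aeW => x n _; rewrite gee0_abs ?lee_fin ?powR_ge0 //.
    by rewrite ge0_ler_powR ?nnegrE // ltW.
  have [_ _] := @dominated_convergence _ _ _ mu setT measurableT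
    (fun n x => (`|g x - phi n x| `^ p)%:E) (fun=> 0%E) (fun x => (`|2 * G x| `^ p)%:E)
    (fun n => measurable_powR_norm p (mB n)) (measurable_cst _) H1 H2 H3.
  by rewrite integral0.
have e2 : 0 < (e / 2) `^ p by rewrite powR_gt0 // divr_gt0.
have [N _ hN] : \forall n \near \oo, (pint p (fun x => (g x - phi n x)%R) <= ((e / 2) `^ p)%:E)%E.
  move/fine_cvgP : cv => [fn /cvgrPdist_le /(_ _ e2)].
  move: fn; apply: filterS2 => n fn; rewrite sub0r normrN /= => h.
  by rewrite -(fineK fn) lee_fin (le_trans (ler_norm _)).
exists N; apply: (@le_lt_trans _ _ (e / 2)); last lra.
by apply: (nrm_le_pint p1'); [rewrite divr_ge0 // ltW|exact: (hN N (leqnn N))].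
Qed.

Variable D : set (R -> R).
Hypothesis Dlin : forall f g k, D f -> D g -> D (fun x => k * f x + g x).
Hypothesis Dlim : forall g, inLp p g ->
  (forall e, 0 < e -> exists phi, [/\ inLp p phi, D phi & nrm p (fun x => g x - phi x) < e]) ->
  D g.

Definition dyadic_ind (N : nat) (k : int) (m : nat) : R -> R :=
  fun x => (k%:~R / 2 ^+ N <= x < (k + m%:Z)%:~R / 2 ^+ N)%R%:R.

Hypothesis Dcell : forall N k, D (dyadic_ind N k 1).

(** The form in which the closedness of [D] is used from here on: dominated pointwise convergence
    implies convergence in L_p. *)
Lemma D_dominated (phi : nat -> R -> R) g G :
  (forall n, measurable_fun [set: R] (phi n)) -> inLp p G ->
  (forall n x, `|phi n x| <= `|G x|) ->
  (forall x, phi ^~ x @ \oo --> g x) -> (forall n, D (phi n)) -> D g.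
Proof.
move=> mphi lG phiG phig Dphi.
have [lg h] := Lp_dominated_cvg mphi lG phiG phig.
apply: Dlim => // e e0; have [n hn] := h e e0.
by exists (phi n); split => //; exact: inLp_dominated (phiG n).
Qed.

Lemma D_zero : D (fun=> 0).
Proof.
have := Dlin (-1) (Dcell 0 0) (Dcell 0 0); congr D.
by apply/funext => x; rewrite mulN1r addNr.
Qed.

Lemma D_scale f k : D f -> D (fun x => k * f x).
Proof.
move=> Df; have := Dlin k Df D_zero; congr D.
by apply/funext => x; rewrite addr0.
Qed.

Lemma D_sum (n : nat) (F : nat -> R -> R) : (forall i, (i < n)%N -> D (F i)) ->
  D (fun x => \sum_(i < n) F i x).
Proof.
elim: n => [|n IH] DF.
  have := D_zero; congr D; apply/funext => x; rewrite big_ord0 //.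
have Dn : D (fun x => \sum_(i < n) F i x).
  by apply: IH => i ni; apply: DF; exact: ltnW.
have := Dlin 1 (DF n (ltnSn n)) Dn; congr D; apply/funext => x.
by rewrite big_ord_recr /= mul1r addrC.
Qed.

Lemma D_dyadic N k m : D (dyadic_ind N k m).
Proof.
elim: m => [|m IH].
  have := D_zero; congr D; apply/funext => x; rewrite /dyadic_ind addr0.
  by rewrite (le_lt_asym _ x).
have := Dlin 1 (Dcell N (k + m%:Z)) IH; congr D; apply/funext => x.
rewrite /dyadic_ind mul1r -addrA -PoszD addn1.
set a := k%:~R / _; set b := (k + m%:Z)%:~R / _; set c := (k + _)%:~R / _.
have P0 : 0 < 2 ^+ N :> R by rewrite exprn_gt0.
have ab : a <= b by rewrite ler_pM2r ?invr_gt0 // ler_int lerDl.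
have bc : b <= c by rewrite ler_pM2r ?invr_gt0 // ler_int lerD2l lez_nat.
have [xb|bx] := ltP x b.
  by rewrite add0r (lt_le_trans xb bc).
by rewrite (le_trans ab bx) /= addr0.
Qed.

(** Indicators of rays or of arbitrary measurable sets need not lie in L_p; multiplied by a window
    they are dominated by an L_p function. *)
Let window (K : nat) (x : R) : R := (- K%:R <= x < K%:R)%R%:R.

Let windowE K : window K = dyadic_ind 0 (- K%:Z) (K + K).
Proof.
apply/funext => x; rewrite /window /dyadic_ind expr0 !divr1 intrN.
by rewrite PoszD addKr.
Qed.

Let measurable_bool (P : R -> bool) : measurable [set x | P x] ->
  measurable_fun [set: R] (fun x => (P x)%:R : R).
Proof.
move=> mP; rewrite (_ : (fun x => _) = \1_[set x | P x]); first exact: measurable_indic.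
apply/funext => x; rewrite indicE; congr (_%:R); congr nat_of_bool.
by apply/idP/idP => [?|/set_mem//]; exact/mem_set.
Qed.

Let measurable_itvco (a b : R) : measurable [set x | a <= x < b].
Proof.
have -> : [set x | a <= x < b] = [set` `[a, b[].
  by apply/funext => x /=; rewrite in_itv.
exact: measurable_itv.
Qed.

Let measurable_dyadic N k m : measurable_fun [set: R] (dyadic_ind N k m).
Proof. by apply: measurable_bool; exact: measurable_itvco. Qed.

Let inLp_window K : inLp p (window K).
Proof.
apply: (inLpP p1' _).2; split; first by rewrite windowE; exact: measurable_dyadic.
have -> : pint p (window K) = mu [set` `[- K%:R, K%:R[].
  rewrite -[in RHS](setIT [set` _]) -integral_indic //.
  apply: eq_integral => x _; congr (_%:E); rewrite /window indicE.
  have -> : (x \in [set` `[- K%:R, K%:R[]) = (- K%:R <= x < K%:R).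
    by apply/idP/idP => [/set_mem|h]; [|apply/mem_set]; rewrite /= in_itv.
  by case: (_ <= x < _); rewrite ?normr1 ?powR1 // normr0 powR0 // gt_eqF.
by rewrite lebesgue_measure_itv /=; case: ifP => _; rewrite -?EFinB ltry.
Qed.

Let windowM_le K (b : bool) x : `|b%:R * window K x| <= `|window K x|.
Proof. by case: b; rewrite ?mul1r // mul0r normr0. Qed.

Lemma cvg_eventually (u : nat -> R) l N : (forall n, (N <= n)%N -> u n = l) ->
  u @ \oo --> l.
Proof.
move=> h; apply: cvg_near_cst; exists N => // n /= Nn; exact: h.
Qed.

(** The right end [Num.min a K%:R] is approached from below by dyadic points, while the left end is
    dyadic already. As the right end is excluded, the indicators converge everywhere, being
    eventually constant at each point. *)
Let D_ray K a : D (fun x => (x < a)%R%:R * window K x).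
Proof.
have [aK|Ka] := lerP a (- K%:R).
  have := D_zero; congr D; apply/funext => x; rewrite /window.
  case: (ltP x a) => xa; last by rewrite mul0r.
  by rewrite mul1r leNgt (lt_le_trans xa aK).
pose b := Num.min a K%:R.
have Kb : - K%:R <= b.
  by rewrite le_min (ltW Ka) /= (@le_trans _ _ 0) // ?oppr_le0 ler0n.
pose an n : int := Num.floor (2 ^+ n * b).
have P0 n : 0 < 2 ^+ n :> R by rewrite exprn_gt0.
have an_ge n : - (K * 2 ^ n)%:Z <= an n.
  rewrite floor_ge_int intrN -[_%:~R]/((K * 2 ^ n)%:R) natrM natrX.
  by rewrite mulrC -mulrN ler_pM2l.
pose m n := absz (an n + Posz (K * 2 ^ n)%N).
have mE n : - (K * 2 ^ n)%:Z + (m n)%:Z = an n.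
  rewrite /m gez0_abs; first by rewrite addrC addrK.
  by have := an_ge n; rewrite -subr_ge0 opprK.
have fE n x : dyadic_ind n (- (K * 2 ^ n)%:Z) (m n) x =
    (- K%:R <= x < (an n)%:~R / 2 ^+ n)%R%:R.
  rewrite /dyadic_ind mE; congr (nat_of_bool (_ && _))%:R.
  rewrite intrN -[(Posz _)%:~R]/((K * 2 ^ n)%:R) natrM natrX mulNr mulfK // gt_eqF.
have anb n : (an n)%:~R / 2 ^+ n <= b.
  by rewrite ler_pdivrMr // mulrC floor_le.
apply: (@D_dominated (fun n => dyadic_ind n (- (K * 2 ^ n)%:Z) (m n)) _ (window K)).
- by move=> n; exact: measurable_dyadic.
- exact: inLp_window.
- move=> n x; rewrite fE /window.
  case: (boolP (- K%:R <= x)) => //= _.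
  case: (ltP x ((an n)%:~R / 2 ^+ n)) => [xa|_]; last by rewrite normr0.
  by rewrite (lt_le_trans (lt_le_trans xa (anb n))) // ge_min lexx orbT.
- move=> x.
  have -> : (x < a)%R%:R * window K x = (- K%:R <= x < b)%R%:R.
    rewrite /window lt_min; case: (x < a); rewrite ?mul1r ?mul0r ?andbF //.
  have [xb|bx] := ltP x b; last first.
    rewrite andbF; apply: (@cvg_eventually _ _ 0) => n _; rewrite fE.
    by rewrite (ltNge x) (le_trans (anb n) bx) andbF.
  have [N hN] : exists N : nat, 1 < 2 ^+ N * (b - x).
    have bx0 : 0 < b - x by rewrite subr_gt0.
    exists (Num.truncn (b - x)^-1).+1.
    rewrite -ltr_pdivrMr // mul1r (lt_trans (truncnS_gt _)) //.
    by rewrite -natrX ltr_nat ltn_expl.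
  apply: (@cvg_eventually _ _ N) => n Nn; rewrite fE.
  suff -> : x < (an n)%:~R / 2 ^+ n by [].
  rewrite ltr_pdivlMr //.
  have := floorD1_gt (2 ^+ n * b); rewrite -/(an n) intrD => h.
  have : 2 ^+ N * (b - x) <= 2 ^+ n * (b - x).
    by rewrite ler_pM2r ?subr_gt0 // ler_eXn2l ?ltr1n.
  rewrite [in leRHS]mulrBr => h2; rewrite [x * _]mulrC; lra.
- by move=> n; exact: D_dyadic.
Qed.

(** Dynkin's induction: the open rays to the left are stable under intersection and generate the
    Borel sets, while linearity gives complements and [D_dominated] gives countable disjoint
    unions. *)
Let D_meas K (A : set R) : measurable A -> D (fun x => \1_A x * window K x).
Proof.
have mE := RGenInftyO.measurableE R.
move=> mA.
have sA : <<s @RGenInftyO.G R >> A by rewrite -[X in X A]mE.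
move: A sA {mA}.
apply: (@dynkin_induction _ (measurableTypeR R) (@RGenInftyO.G R)
  (fun A : set R => D (fun x => \1_A x * window K x))).
- exact: mE.
- move=> _ _ [x ->] [y ->]; exists (Num.min x y).
  by apply/funext => z; rewrite /= !in_itv /=; apply/propext; rewrite lt_min; split=> [[-> ->]|/andP[]].
- have := D_dyadic 0 (- K%:Z) (K + K); rewrite -windowE; congr D.
  by apply/funext => x; rewrite indicT mul1r.
- move=> _ [a ->]; have := D_ray K a; congr D; apply/funext => x.
  congr (_ * _); rewrite indicE; congr (_%:R); congr nat_of_bool.
  by apply/idP/idP => [h|/set_mem]; [apply/mem_set|]; rewrite /= in_itv.
- move=> S mS DS.
  have DW : D (window K) by rewrite windowE; exact: D_dyadic.
  have := Dlin (-1) DS DW; congr D; apply/funext => x.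
  rewrite !indicE in_setC; case: (x \in S) => /=; rewrite ?mul1r ?mul0r; ring.
- move=> F mF tF DF.
  apply: (@D_dominated (fun n x => \1_(\big[setU/set0]_(i < n) F i) x * window K x) _ (window K)).
  + move=> n; apply: measurable_funM; last exact: (inLp_window K).1.
    by apply: measurable_indic; apply: bigsetU_measurable => i _; exact: mF.
  + exact: inLp_window.
  + by move=> n x; rewrite indicE; exact: windowM_le.
  + move=> x; have [[k _ Fk]|nF] := pselect ((\bigcup_k F k) x).
      apply: (@cvg_eventually _ _ k.+1) => n kn.
      have e1 : x \in \bigcup_k F k by apply/mem_set; exists k.
      have e2 : x \in \big[setU/set0]_(i < n) F i.
        by apply/mem_set; rewrite -bigcup_mkord; exists k.
      by rewrite !indicE e1 e2.
    apply: (@cvg_eventually _ _ 0) => n _.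
    rewrite !indicE !memNset // -bigcup_mkord => -[k _ Fk].
    by apply: nF; exists k.
  + move=> n; have := @D_sum n (fun i x => \1_(F i) x * window K x) (fun i _ => DF i).
    congr D; apply/funext => x; rewrite -mulr_suml; congr (_ * _).
    elim: n => [|n IH]; first by rewrite !big_ord0 indic0.
    rewrite !big_ord_recr /= IH !indicE in_setU.
    case: (boolP (x \in F n)) => [/set_mem xn|_]; last by rewrite orbF addr0.
    rewrite orbT memNset ?add0r // -bigcup_mkord => -[i /= ni xi].
    have := tF i n I I; rewrite /= => /(_ (ex_intro _ x (conj xi xn))) ein.
    by move: ni; rewrite ein ltnn.
Qed.

Let D_nonneg g : inLp p g -> (forall x, 0 <= g x) -> D g.
Proof.
move=> lg g0.
have P0 n : 0 < 2 ^+ n :> R by rewrite exprn_gt0.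
pose B n k := g @^-1` [set` `[k%:R / 2 ^+ n, k.+1%:R / 2 ^+ n[].
have mB n k : measurable (B n k).
  by rewrite -[B n k]setTI; apply: lg.1 => //; exact: measurable_itv.
pose q n x := Num.truncn (2 ^+ n * g x).
have BE n k x : \1_(B n k) x = (k == q n x)%:R :> R.
  have -> : (k == q n x) = (k%:R / 2 ^+ n <= g x < k.+1%:R / 2 ^+ n).
    rewrite eq_sym truncn_eq; last by rewrite mulr_ge0 // ltW.
    by rewrite ler_pdivrMr // ltr_pdivlMr // [g x * _]mulrC.
  rewrite indicE; congr (_%:R); congr nat_of_bool.
  by apply/idP/idP => [/set_mem|h]; [|apply/mem_set]; rewrite /B /= in_itv.
(* Values of [g] are rounded down to multiples of [2 ^- n], and replaced by 0 outside the window and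
   where [g] reaches [n]. *)
pose phi n x := \sum_(k < n * 2 ^ n) k%:R / 2 ^+ n * (\1_(B n k) x * window n x).
have phiE n x : phi n x = if (q n x < n * 2 ^ n)%N then
    (q n x)%:R / 2 ^+ n * window n x else 0.
  rewrite /phi; under eq_bigr do rewrite BE.
  case: ifPn => [qn|qn].
    rewrite (bigD1 (Ordinal qn)) //= eqxx mul1r big1 ?addr0 // => k.
    by rewrite -val_eqE /= => /negbTE ->; rewrite mul0r mulr0.
  rewrite big1 // => k _; case: eqP => [kq|]; last by rewrite mul0r mulr0.
  by move: qn; rewrite -kq ltn_ord.
have q_le n x : (q n x)%:R / 2 ^+ n <= g x.
  by rewrite ler_pdivrMr // mulrC truncn_le mulr_ge0 // ltW.
have w01 n x : 0 <= window n x <= 1 by rewrite /window; case: (_ <= x < _); rewrite ?lexx ?ler01.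
have q0 n x : 0 <= (q n x)%:R / 2 ^+ n :> R by rewrite divr_ge0 // ltW.
apply: (@D_dominated phi g g) => //.
- move=> n; apply: measurable_sum => k; apply: measurable_funM => //.
  apply: measurable_funM; first exact: measurable_indic.
  exact: (inLp_window n).1.
- move=> n x; rewrite phiE; case: ifP => _; last by rewrite normr0.
  have /andP[w0 w1] := w01 n x.
  rewrite !ger0_norm ?mulr_ge0 //.
  by apply: le_trans (q_le n x); rewrite ler_piMr.
- move=> x; apply/cvgrPdist_le => e e0.
  have [m hm] := inv_nat_small 1 e0; rewrite mul1r in hm.
  pose N := maxn m.+1 (maxn (Num.truncn (g x)).+1 (Num.truncn `|x|).+1).
  exists N => // n /= Nn.
  have n1 : (m < n)%N by apply: leq_trans Nn; rewrite leq_max ltnSn.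
  have n2 : g x < n%:R.
    apply: lt_le_trans (truncnS_gt _) _; rewrite ler_nat.
    by apply: leq_trans Nn; rewrite !leq_max leqnn orbT.
  have n3 : `|x| < n%:R.
    apply: lt_le_trans (truncnS_gt _) _; rewrite ler_nat.
    by apply: leq_trans Nn; rewrite !leq_max leqnn !orbT.
  have -> : phi n x = (q n x)%:R / 2 ^+ n.
    rewrite phiE ifT; last first.
      rewrite truncn_lt_nat; last by rewrite mulr_ge0 // ltW.
      by rewrite natrM natrX mulrC ltr_pM2r.
    rewrite /window; move: n3; rewrite ltr_norml => /andP[h1 h2].
    by rewrite (ltW h1) h2 mulr1.
  rewrite ger0_norm ?subr_ge0 //.
  apply: ltW; apply: le_lt_trans hm.
  have : g x < ((q n x)%:R + 1) / 2 ^+ n.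
    by rewrite ltr_pdivlMr // natr1 mulrC truncnS_gt.
  rewrite mulrDl mul1r => h.
  have : (2 ^+ n)^-1 <= m.+1%:R^-1 :> R.
    rewrite lef_pV2 ?posrE ?ltr0n // -natrX ler_nat.
    by apply: leq_trans n1 _; rewrite ltnW // ltn_expl.
  move: h; set a := _ / _; set b := (2 ^+ n)^-1; set c := m.+1%:R^-1 => h1 h2.
  lra.
- move=> n.
  apply: (@D_sum _ (fun k x => k%:R / 2 ^+ n * (\1_(B n k) x * window n x))) => k _.
  by apply: D_scale; exact: D_meas.
Qed.

Lemma Lp_dense g : inLp p g -> D g.
Proof.
move=> lg.
pose gp x := (`|g x| + g x) / 2; pose gn x := (`|g x| - g x) / 2.
have mabs : measurable_fun [set: R] (fun x => `|g x|).
  by apply: measurableT_comp => //; exact: lg.1.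
have lp : inLp p gp.
  apply: (inLp_dominated _ lg).
    by apply: measurable_funM => //; apply: measurable_funD => //; exact: lg.1.
  move=> x; have := ler_norm (g x); have := ler_norm (- g x); rewrite normrN /gp.
  by move=> h1 h2; rewrite ger0_norm; lra.
have ln : inLp p gn.
  apply: (inLp_dominated _ lg).
    by apply: measurable_funM => //; apply: measurable_funB => //; exact: lg.1.
  move=> x; have := ler_norm (g x); have := ler_norm (- g x); rewrite normrN /gn.
  by move=> h1 h2; rewrite ger0_norm; lra.
have dp : D gp.
  by apply: D_nonneg => // x; have := ler_norm (- g x); rewrite normrN /gp; lra.
have dn : D gn.
  by apply: D_nonneg => // x; have := ler_norm (g x); rewrite /gn; lra.
have := Dlin (-1) dn dp; congr D; apply/funext => x; rewrite /gp /gn; lra.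
Qed.

End LpDensity.

(** * Indexing *)

Section Combinatorics.
Local Open Scope nat_scope.

Lemma base4_digits_unique E (c d : nat -> nat) :
  (forall e, c e < 4) -> (forall e, d e < 4) ->
  \sum_(e < E) c e * 4 ^ e = \sum_(e < E) d e * 4 ^ e ->
  forall e, e < E -> c e = d e.
Proof.
elim: E c d => [//|E IH] c d c4 d4; rewrite !big_ord_recl /= !expn0 !muln1.
have shift (u : nat -> nat) : \sum_(i < E) u (bump 0 i) * 4 ^ bump 0 i =
    4 * \sum_(i < E) u i.+1 * 4 ^ i.
  rewrite big_distrr; apply: eq_bigr => i _ /=; rewrite /bump leq0n add1n expnS.
  by rewrite mulnCA.
rewrite (shift c) (shift d) => h.
have h0 : c 0 = d 0 by have := c4 0; have := d4 0; lia.
have h1 : \sum_(e < E) c e.+1 * 4 ^ e = \sum_(e < E) d e.+1 * 4 ^ e.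
  by move: h; rewrite h0; lia.
case=> [_ //|e eE]; apply: (IH (fun e => c e.+1) (fun e => d e.+1)) => //.
Qed.

(** The base-4 digits of a sum of three powers of 4 are the multiplicities of the exponents: they
    are at most 3, so nothing is carried. *)
Lemma sum3_pow4_unique x y z x' y' z' :
  4 ^ x + 4 ^ y + 4 ^ z = 4 ^ x' + 4 ^ y' + 4 ^ z' ->
  forall e, (e == x) + (e == y) + (e == z) = (e == x') + (e == y') + (e == z').
Proof.
pose E := (maxn x (maxn y (maxn z (maxn x' (maxn y' z'))))).+1.
have S1 u : u < E -> \sum_(e < E) (e == u :> nat) * 4 ^ e = 4 ^ u.
  move=> uE; rewrite (bigD1 (Ordinal uE)) //= eqxx mul1n big1 ?addn0 // => i.
  by rewrite -val_eqE /= => /negbTE ->.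
have S3 u v w : u < E -> v < E -> w < E ->
    \sum_(e < E) ((e == u :> nat) + (e == v :> nat) + (e == w :> nat)) * 4 ^ e =
    4 ^ u + 4 ^ v + 4 ^ w.
  move=> uE vE wE; rewrite -(S1 u) // -(S1 v) // -(S1 w) // -!big_split /=.
  by apply: eq_bigr => e _; rewrite !mulnDl.
have b4 u v w e : (e == u :> nat) + (e == v :> nat) + (e == w :> nat) < 4.
  by case: (e == u); case: (e == v); case: (e == w).
have [xE [yE zE]] : x < E /\ y < E /\ z < E.
  by rewrite /E !ltnS !leq_max !leqnn !orbT.
have [xE' [yE' zE']] : x' < E /\ y' < E /\ z' < E.
  by rewrite /E !ltnS !leq_max !leqnn !orbT.
rewrite -(S3 x y z) // -(S3 x' y' z') //.
clearbody E => h e; have [eE|Ee] := ltnP e E.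
  exact: (@base4_digits_unique E (fun e => (e == x) + (e == y) + (e == z))
    (fun e => (e == x') + (e == y') + (e == z'))).
have ne u : u < E -> (e == u) = false.
  by move=> uE; apply/eqP => eu; move: Ee; rewrite eu leqNgt uE.
by rewrite !ne.
Qed.

(** A bijective pairing for which [dec1 i <= i] and [dec2 i <= i]; the first [I] items thus involve
    only levels and positions below [I]. *)
Definition enc k l : nat := (2 ^ k * l.*2.+1).-1.
Definition dec1 i : nat := logn 2 i.+1.
Definition dec2 i : nat := (i.+1 %/ 2 ^ dec1 i)./2.

Lemma encS k l : (enc k l).+1 = 2 ^ k * l.*2.+1.
Proof. by rewrite /enc prednK // muln_gt0 expn_gt0. Qed.

Lemma dec1_enc k l : dec1 (enc k l) = k.
Proof.
rewrite /dec1 encS lognM ?expn_gt0 // pfactorK // lognE /= dvdn2 /= odd_double.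
by rewrite addn0.
Qed.

Lemma dec2_enc k l : dec2 (enc k l) = l.
Proof. by rewrite /dec2 dec1_enc encS mulKn ?expn_gt0 //= uphalf_double. Qed.

Lemma decK i : enc (dec1 i) (dec2 i) = i.
Proof.
rewrite /enc /dec2; set q := i.+1 %/ _.
have qE : i.+1 = 2 ^ dec1 i * q by rewrite mulnC divnK // pfactor_dvdnn.
have oq : odd q.
  have [m] := @pfactor_coprime 2 i.+1 isT isT; rewrite coprime2n -/(dec1 i) => om mE.
  suff -> : q = m by [].
  by rewrite /q mE mulnK // expn_gt0.
by have := odd_double_half q; rewrite oq add1n => ->; rewrite -qE.
Qed.

Lemma dec1_le i : dec1 i <= i.
Proof.
rewrite -[X in _ <= X]decK -ltnS encS.
by apply: leq_trans (ltn_expl _ (ltnSn 1)) _; rewrite leq_pmulr.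
Qed.

Lemma dec2_le i : dec2 i <= i.
Proof.
rewrite -[X in _ <= X]decK -ltnS encS.
apply: leq_trans (_ : (dec2 i).*2.+1 <= _); first by rewrite ltnS -addnn leq_addr.
by rewrite leq_pmull // expn_gt0.
Qed.

Section Blocks.
Variable Nb : nat -> nat.
Hypothesis Nb0 : forall i, 0 < Nb i.

Definition offset I : nat := \sum_(i < I) Nb i.

Lemma offsetS I : offset I.+1 = offset I + Nb I.
Proof. by rewrite /offset big_ord_recr. Qed.

Lemma leq_offset I : I <= offset I.
Proof.
elim: I => // I IH; rewrite offsetS -addn1; apply: leq_add IH (Nb0 I).
Qed.

Lemma offset_mono I J : I <= J -> offset I <= offset J.
Proof.
apply: (@homo_leq _ _ leq leqnn leq_trans) => K.
by rewrite offsetS leq_addr.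
Qed.

Lemma blk_exists m : exists i, m < offset i.+1.
Proof. by exists m; exact: leq_offset. Qed.

Definition blk m : nat := ex_minn (blk_exists m).

Lemma blkP m i : (blk m == i) = (offset i <= m < offset i.+1).
Proof.
rewrite /blk; case: ex_minnP => b mb bmin; apply/eqP/andP => [<-|[h1 h2]].
  split=> //; case: b mb bmin => [|b] mb bmin; first by rewrite /offset big_ord0.
  by rewrite leqNgt; apply/negP => /bmin; rewrite ltnn.
apply/eqP; rewrite eqn_leq bmin //= leqNgt; apply/negP => bi.
by move: mb; rewrite ltnNge (leq_trans (offset_mono bi) h1).
Qed.

Lemma blk_le m : blk m <= m.
Proof.
have := blkP m (blk m); rewrite eqxx => /esym/andP[h _].
exact: leq_trans (leq_offset _) h.
Qed.

Lemma sum_blocks (R : nmodType) (F : nat -> R) I :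
  (\sum_(m < offset I) F (blk m) = \sum_(i < I) F i *+ Nb i)%R.
Proof.
elim: I => [|I IH]; first by rewrite [offset 0]big_ord0 !big_ord0.
rewrite big_ord_recr /= -IH offsetS big_split_ord /=; congr (_ + _)%R.
rewrite (eq_bigr (fun=> F I)) ?sumr_const ?card_ord // => i _.
congr F; apply/eqP; rewrite blkP leq_addr /= offsetS ltn_add2l //.
Qed.

End Blocks.

End Combinatorics.

Section MartingaleExpansion.
Variables (R : realType) (f0 : nat -> R) (c : nat -> nat -> R).

(** The level-[k] ancestor of [t] is [t %/ 2 ^ (n - k)], and the parity of the ancestor one level
    further down tells which child was taken. *)
Lemma dmartE n t : dmart f0 c n t = f0 (t %/ 2 ^ n)%N +
  \sum_(k < n) (-1) ^+ odd (t %/ 2 ^ (n - k.+1))%N * c k (t %/ 2 ^ (n - k))%N.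
Proof.
elim: n t => [|n IH] t; first by rewrite big_ord0 addr0 divn1.
rewrite big_ord_recr /= subnn divn1 subSnn expn1 divn2 IH -addrA; congr (_ + _).
  by rewrite expnS divnMA divn2.
congr (_ + _); apply: eq_bigr => k _.
by rewrite subSS subSn ?(ltnW (ltn_ord k)) // expnS divnMA divn2 -divn2 -divnMA -expnS
  divn2 subnSK.
Qed.

Lemma sqfunE n t : sqfun f0 c n t = f0 (t %/ 2 ^ n)%N ^+ 2 +
  \sum_(k < n) c k (t %/ 2 ^ (n - k))%N ^+ 2.
Proof.
elim: n t => [|n IH] t; first by rewrite big_ord0 addr0 divn1.
rewrite big_ord_recr /= subSnn expn1 divn2 IH -addrA; congr (_ + _).
  by rewrite expnS divnMA divn2.
congr (_ + _); apply: eq_bigr => k _.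
by rewrite subSn ?(ltnW (ltn_ord k)) // expnS divnMA divn2.
Qed.

End MartingaleExpansion.

Lemma sum_divn (R : nmodType) (F : nat -> R) L D : (0 < D)%N ->
  \sum_(t < L * D) F (t %/ D)%N = \sum_(q < L) F q *+ D.
Proof.
move=> D0; elim: L => [|L IH]; first by rewrite mul0n !big_ord0.
rewrite mulSn addnC big_split_ord /= IH big_ord_recr /=; congr (_ + _).
rewrite (eq_bigr (fun=> F L)) ?sumr_const ?card_ord // => i _.
by rewrite divnMDl // divn_small // addn0.
Qed.

Lemma powR_sum_superadditive (R : realType) (r : R) (I : Type) (s : seq I) (F : I -> R) :
  1 < r -> (forall i, 0 <= F i) ->
  \sum_(i <- s) F i `^ r <= (\sum_(i <- s) F i) `^ r.
Proof.
move=> r1 F0; elim: s => [|i s IH]; first by rewrite !big_nil powR_ge0.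
rewrite !big_cons; apply: le_trans (powR_superadditive r1 _ _) => //.
  by rewrite lerD2l.
by rewrite sumr_ge0.
Qed.

Lemma powR_sqr (R : realType) (p x : R) : `|x| `^ p = (x ^+ 2) `^ (p / 2).
Proof.
rewrite -[x ^+ 2](real_normK (num_real x)).
by rewrite -powR_mulrn // -powRrM mulrCA mulfV // mulr1.
Qed.

(** Odd exponents here and even ones in [lam], so that a column cannot be mistaken for a shift in a
    sum. *)
Definition column (j : nat) : int := Posz (4 ^ j.*2.+1).
Definition lam (m : nat) : int := Posz (4 ^ m.*2).

(** The arithmetic behind all disjointness of supports. Two shifts occur on each side because piece
    [k] sits at a column minus [lam k] and is then moved by [lam m]; clearing the minus signs in an
    equality of two such positions gives this shape. *)
Lemma column_lam_unique i j a b c d :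
  column i + lam a + lam b = column j + lam c + lam d ->
  i = j /\ (a = c /\ b = d \/ a = d /\ b = c).
Proof.
rewrite /column /lam -!PoszD => -[] /sum3_pow4_unique h.
have ij : i = j.
  have := h i.*2.+1; rewrite eqxx.
  have od u : (i.*2.+1 == u.*2) = false by apply/negbTE/eqP; lia.
  rewrite !od !addn0 eqSS; case: eqP => // ij _.
  by move: ij => /(congr1 half); rewrite !doubleK.
split=> //; subst j.
have eo u v : (u.*2 == v.*2.+1) = false by apply/negbTE/eqP; lia.
have ee u v : (u.*2 == v.*2) = (u == v).
  by apply/eqP/eqP => [/(congr1 half)|->//]; rewrite !doubleK.
have h' u : ((u == a) + (u == b) = (u == c) + (u == d))%N.
  by have := h u.*2; rewrite !eo !ee.
have [ac|ac] := eqVneq a c.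
  left; split=> //; have := h' b; rewrite ac eqxx => /addnI.
  by case: eqP.
right; have := h' a; rewrite eqxx (negbTE ac) add0n.
case: (a =P d) => [ad _|_ //]; split=> //.
have := h' b; rewrite eqxx -ad addnC => /addIn.
by case: (b =P c).
Qed.

Lemma column_inj : injective column.
Proof. by move=> i j ij; case: (@column_lam_unique i j 0 0 0 0) => //; rewrite ij. Qed.

Lemma lam_inj : injective lam.
Proof.
move=> i j ij; have h : column 0 + lam i + lam 0 = column 0 + lam j + lam 0 by rewrite ij.
by case: (column_lam_unique h) => _ [[]|[-> <-]].
Qed.

(** * The translated function *)

Section TranslatedFunction.
Variables (R : realType) (p : R).
Hypothesis p4 : 4 < p.
Variables (amp : nat -> R) (lvl pos : nat -> nat).
Hypothesis amp_gt0 : forall m, 0 < amp m.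
Hypothesis lvl_le : forall m, (lvl m <= m)%N.
Hypothesis pos_le : forall m, (pos m <= m)%N.
Hypothesis amp_sum : forall n, \sum_(m < n) amp m `^ p <= 1.

Local Notation mu := (@lebesgue_measure R).
Implicit Types (x : R) (b : nat -> R).

Let p1 : 1 < p. Proof. by apply: lt_trans p4; rewrite ltr1n. Qed.
Let p1' : 1 <= p. Proof. exact: ltW. Qed.
Let p0 : 0 < p. Proof. exact: lt_trans p1. Qed.
Let r2 : 2 < p / 2. Proof. by rewrite ltr_pdivlMr // -natrM. Qed.

(** At level [m.+1] the m-th Rademacher function is constant on cells, with sign [(-1) ^+ odd t].
    Since [lvl m <= m], the carrying interval is never finer than the oscillation. *)
Definition atom_val m t : R :=
  amp m * ((t %/ 2 ^ (m.+1 - lvl m) == pos m)%N%:R * (-1) ^+ odd t).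

Definition atom m : R -> R := stepf column m.+1 (atom_val m).

Lemma atom_val_supp m t : (m.+1 * 2 ^ m.+1 <= t)%N -> atom_val m t = 0.
Proof.
move=> mt; rewrite /atom_val; case: eqP => [tp|_]; last by rewrite mul0r mulr0.
have : (m.+1 <= t %/ 2 ^ (m.+1 - lvl m))%N.
  rewrite leq_divRL ?expn_gt0 //; apply: leq_trans mt.
  by rewrite leq_mul2l leq_exp2l // leq_subr orbT.
by rewrite tp ltnNge pos_le.
Qed.

Lemma measurable_atom m : measurable_fun [set: R] (atom m).
Proof. exact: (measurable_stepf column_inj _ (@atom_val_supp m)). Qed.

Definition atom_col m : nat := (pos m %/ 2 ^ lvl m)%N.

Lemma atom_neq0 m x : atom m x != 0 -> column (atom_col m) = Num.floor x.
Proof.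
rewrite /atom /stepf; case: ifPn => [u0|]; last by rewrite eqxx.
have [j Mj] := unf_ge0P column_inj x u0.
rewrite /atom_val; case: (_ %/ _ =P pos m)%N => [tp _|_]; last first.
  by rewrite mul0r mulr0 eqxx.
rewrite -Mj /atom_col -tp -divnMA -expnD subnK; last exact: leqW.
congr column; rewrite -(lev0 (unf_bounds column_inj Mj)).
by rewrite [RHS](lev_div u0 (leq0n m.+1)) subn0.
Qed.

Lemma atom_le m x : `|atom m x| <= amp m.
Proof.
have a0 := ltW (amp_gt0 m).
rewrite /atom /stepf; case: ifPn => _; last by rewrite normr0.
rewrite /atom_val !normrM normrX normrN1 expr1n mulr1 ger0_norm //.
by rewrite ler_piMr // ger0_norm // lern1 leq_b1.
Qed.

Lemma atom_shift_unique x m n :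
  atom m (x + (lam m)%:~R) != 0 -> atom n (x + (lam n)%:~R) != 0 -> m = n.
Proof.
move=> /atom_neq0 hm /atom_neq0 hn.
move: hm hn; rewrite !floorDrz ?intr_int // !intrKfloor => hm hn.
(* [lam 0] only pads both sides to three terms. *)
have : column (atom_col m) + lam n + lam 0 = column (atom_col n) + lam m + lam 0.
  by rewrite hm hn; ring.
by move=> /column_lam_unique [_ [[]|[-> <-]]].
Qed.

Definition base_partial n x : R := \sum_(m < n) atom m (x + (lam m)%:~R).

(** At each point at most one shifted atom is nonzero, so the limit is that of an eventually
    constant sequence. *)
Definition base x : R := limn (base_partial ^~ x).

Lemma base_partialE x m n : (forall k, k != m -> atom k (x + (lam k)%:~R) = 0) ->
  (m < n)%N -> base_partial n x = atom m (x + (lam m)%:~R).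
Proof.
move=> h mn; rewrite /base_partial (bigD1 (Ordinal mn)) //= big1 ?addr0 //.
by move=> k km; apply: h; exact: km.
Qed.

Lemma shifted_atoms x : exists m,
  forall k, k != m -> atom k (x + (lam k)%:~R) = 0.
Proof.
have [[m hm]|h] := pselect (exists m, atom m (x + (lam m)%:~R) != 0).
  exists m => k km; apply/eqP; apply: contraNT km => hk.
  by apply/eqP; exact: atom_shift_unique hk hm.
by exists 0%N => k _; apply/eqP; apply: contrapT => /negP hk; apply: h; exists k.
Qed.

Lemma base_cvg x : base_partial ^~ x @ \oo --> base x.
Proof.
have [m hm] := shifted_atoms x.
have h : base_partial ^~ x @ \oo --> atom m (x + (lam m)%:~R).
  by apply: (@cvg_eventually _ _ _ m.+1) => n; exact: base_partialE.
by rewrite /base (cvg_lim _ h).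
Qed.

Lemma baseE x m : (forall k, k != m -> atom k (x + (lam k)%:~R) = 0) ->
  base x = atom m (x + (lam m)%:~R).
Proof.
move=> hm; apply: cvg_lim => //.
by apply: (@cvg_eventually _ _ _ m.+1) => n; exact: base_partialE.
Qed.

Lemma measurable_shift (F : R -> R) (a : R) : measurable_fun [set: R] F ->
  measurable_fun [set: R] (fun x => F (x + a)).
Proof.
move=> mF; apply: measurableT_comp mF _.
exact: measurable_funD.
Qed.

Lemma measurable_base : measurable_fun [set: R] base.
Proof.
apply: (@measurable_fun_cvg _ _ _ setT base_partial base) => [n|x _].
  by apply: measurable_sum => m; apply: measurable_shift; exact: measurable_atom.
exact: base_cvg.
Qed.

Lemma base_partial_pow n x : `|base_partial n x| `^ p <=
  \sum_(m < n) amp m `^ p * \1_[set y | column (atom_col m) = Num.floor (y + (lam m)%:~R)] x.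
Proof.
have [m hm] := shifted_atoms x.
have S0 : 0 <= \sum_(m < n) amp m `^ p *
    \1_[set y | column (atom_col m) = Num.floor (y + (lam m)%:~R)] x.
  by apply: sumr_ge0 => k _; rewrite mulr_ge0 // powR_ge0.
have [->|nz] := eqVneq (base_partial n x) 0.
  by rewrite normr0 powR0 // gt_eqF.
have mn : (m < n)%N.
  rewrite ltnNge; apply: contraNN nz => nm; rewrite /base_partial big1 // => k _.
  by apply: hm; rewrite neq_ltn (leq_trans (ltn_ord k) nm).
rewrite (base_partialE hm mn) in nz *.
rewrite (bigD1 (Ordinal mn)) //= indicE mem_set; last exact: atom_neq0.
rewrite mulr1; apply: ler_wpDr.
  by apply: sumr_ge0 => k _; rewrite mulr_ge0 // powR_ge0.
by rewrite ge0_ler_powR ?nnegrE ?(ltW p0) ?(ltW (amp_gt0 m)) ?atom_le.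
Qed.

Let mu_unit_column (a k : int) :
  measurable [set y : R | a = Num.floor (y + k%:~R)] /\
  mu [set y : R | a = Num.floor (y + k%:~R)] = 1%E.
Proof.
have -> : [set y : R | a = Num.floor (y + k%:~R)] =
    [set` `[(a - k)%:~R, (a - k)%:~R + 1[].
  apply/funext => y; apply/propext; rewrite /= in_itv /= intrB.
  split=> [->|/andP[h1 h2]].
    have := floor_itv (y + k%:~R); rewrite intrD => /andP[h1 h2].
    by apply/andP; split; lra.
  by apply/esym/floor_def; rewrite intrD; apply/andP; split; lra.
split; first exact: measurable_itv.
rewrite lebesgue_measure_itv /= lte_fin ltrDl ltr01 -EFinB.
by congr (_%:E); rewrite addrC addKr.
Qed.

(** Atom [m] is bounded by [amp m] and lives on one unit column, so the partial sums have p-th power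
    integral at most the sum of the [amp m ^ p]; Fatou's lemma gives the limit. *)
Lemma pint_translate_base l : (pint p (translate base l) <= 1%:E)%E.
Proof.
pose F n x := (`|base_partial n (x + - l%:~R)| `^ p)%:E.
have mB n : measurable_fun [set: R] (base_partial n).
  by apply: measurable_sum => m; apply: measurable_shift; exact: measurable_atom.
have mF n : measurable_fun [set: R] (F n).
  by apply: measurable_powR_norm; exact: measurable_shift.
have -> : pint p (translate base l) = (\int[mu]_x limn_einf (F ^~ x))%E.
  apply: eq_integral => x _.
  have : F ^~ x @ \oo --> (`|translate base l x| `^ p)%:E.
    apply: cvg_EFin; first by apply: nearW.
    by apply: cvg_powR => //; apply: cvg_norm; exact: base_cvg.
  by move=> /cvg_limn_einf_sup [-> _].
apply: le_trans (fatou mu measurableT mF _) _.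
  by move=> k x _; rewrite lee_fin powR_ge0.
apply: limn_einf_le => n.
pose C m := [set y : R | column (atom_col m) = Num.floor (y + (lam m - l)%:~R)].
have mC m : measurable (C m) by exact: (mu_unit_column _ _).1.
pose S x := \sum_(m < n) amp m `^ p * \1_(C m) x.
apply: (@le_trans _ _ (\int[mu]_x (S x)%:E)%E).
  apply: ge0_le_integral; first exact: measurableT.
  - by move=> x _; rewrite lee_fin powR_ge0.
  - exact: mF.
  - apply/measurable_EFinP; apply: measurable_sum => m.
    by apply: measurable_funM => //; apply: measurable_indic; exact: mC.
  - move=> x _; rewrite lee_fin.
    have := base_partial_pow n (x + - l%:~R); congr (_ <= _).
    apply: eq_bigr => m _; congr (_ * _); rewrite !indicE; congr (_%:R).
    have e : x + - l%:~R + (lam m)%:~R = x + (lam m - l)%:~R by rewrite intrB; ring.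
    by congr nat_of_bool; apply/idP/idP => /set_mem h; apply/mem_set; move: h;
      rewrite /C /= e.
under eq_integral do rewrite /S -sumEFin.
rewrite ge0_integral_sum //; last 2 first.
- by move=> m; apply/measurable_EFinP; apply: measurable_funM => //; apply: measurable_indic; exact: mC.
- by move=> m x _; rewrite lee_fin mulr_ge0 // powR_ge0.
rewrite (eq_bigr (fun m : 'I_n => (amp m `^ p)%:E)); last first.
  move=> m _; under eq_integral do rewrite EFinM.
  rewrite ge0_integralZl //; last 2 first.
  - by apply/measurable_EFinP; apply: measurable_indic; exact: mC.
  - by rewrite lee_fin powR_ge0.
  rewrite integral_indic //; last exact: mC.
  rewrite setIT.
  transitivity ((amp m `^ p)%:E * 1%E)%E; last by rewrite mule1.
  by congr (_ * _)%E; exact: (mu_unit_column _ _).2.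
by rewrite sumEFin lee_fin; exact: amp_sum.
Qed.

Lemma inLp_translate_base l : inLp p (translate base l).
Proof.
apply: (inLpP p1' _).2; split.
  by apply: (@measurable_shift base (- l%:~R)); exact: measurable_base.
by apply: le_lt_trans (pint_translate_base l) _; rewrite ltry.
Qed.

Lemma inLp_base : inLp p base.
Proof.
by apply: eq_inLp (inLp_translate_base 0) => x; rewrite /translate subr0.
Qed.

End TranslatedFunction.

(** * The norm of a combination of translates *)

Section NormFormula.
Variables (R : realType) (p : R).
Hypothesis p4 : 4 < p.
Variables (amp : nat -> R) (lvl pos : nat -> nat).
Hypothesis amp_gt0 : forall m, 0 < amp m.
Hypothesis lvl_le : forall m, (lvl m <= m)%N.
Hypothesis pos_le : forall m, (pos m <= m)%N.
Hypothesis amp_sum : forall n, \sum_(m < n) amp m `^ p <= 1.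

Local Notation mu := (@lebesgue_measure R).
Local Notation atom := (atom amp lvl pos).
Local Notation base := (base amp lvl pos).
Local Notation tr m := (translate base (lam m)).
Implicit Types (x : R) (b : nat -> R).

Let p1 : 1 < p. Proof. by apply: lt_trans p4; rewrite ltr1n. Qed.
Let p1' : 1 <= p. Proof. exact: ltW. Qed.
Let p0 : 0 < p. Proof. exact: lt_trans p1. Qed.
Let r2 : 2 < p / 2. Proof. by rewrite ltr_pdivlMr // -natrM. Qed.

Let ltr l : inLp p (translate base l).
Proof. exact: (inLp_translate_base p4 amp_gt0 lvl_le pos_le amp_sum). Qed.

(** If piece [n] met column [j] after the shift by [lam m], its own column plus [lam m] would equal
    [column j + lam n], which forces [m = n]. *)
Lemma translate_on_columns m x : 0 <= unf column x -> tr m x = atom m x.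
Proof.
move=> /(unf_ge0P column_inj) [j Mj].
have [n hn] := shifted_atoms amp pos lvl_le (x - (lam m)%:~R).
rewrite /translate (baseE hn).
have [->|nm] := eqVneq n m; first by rewrite subrK.
have hm := hn m; rewrite eq_sym nm subrK in hm; rewrite hm //.
apply/eqP; apply: contraNT nm => /(atom_neq0 lvl_le) h; apply/eqP.
have : column (atom_col lvl pos n) + lam m + lam 0 = column j + lam n + lam 0.
  move: h; rewrite -addrA -rmorphN -rmorphD floorDrz ?intr_int // intrKfloor -Mj => ->.
  by ring.
by move=> /column_lam_unique [_ [[]|[-> <-]]].
Qed.

Lemma translate_neq0 m x : tr m x != 0 ->
  exists a j, column j + lam m = Num.floor x + lam a.
Proof.
have [a ha] := shifted_atoms amp pos lvl_le (x - (lam m)%:~R).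
rewrite /translate (baseE ha) => /(atom_neq0 lvl_le) h.
exists a, (atom_col lvl pos a); move: h.
rewrite -addrA -rmorphN -rmorphD floorDrz ?intr_int // intrKfloor => ->.
by ring.
Qed.

(** Uniqueness leaves [m = n] or [m = a], where [a] is the piece seen at [x] in the first translate;
    in the latter case the two shifts cancel and [x] lies on a column. *)
Lemma translate_off_columns m n x : unf column x < 0 ->
  tr m x != 0 -> tr n x != 0 -> m = n.
Proof.
move=> u0 /translate_neq0 [a [i hm]] /translate_neq0 [c [j hn]].
have : column i + lam m + lam c = column j + lam n + lam a.
  by rewrite hm hn; ring.
move=> /column_lam_unique [ij [[]//|[ma cn]]].
move: u0; rewrite ltNge => /negP[]; apply/(unf_ge0P column_inj).
by exists i; apply: (addIr (lam m)); rewrite hm ma.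
Qed.

Definition off x : R := \1_(~` \bigcup_t cell column 0 t) x.

Lemma offE x : off x = (unf column x < 0)%R%:R.
Proof.
rewrite /off indicE; congr (_%:R); congr nat_of_bool; rewrite ltNge.
apply/idP/negP => [/set_mem h /(unf_ge0P column_inj) [j Mj]|h].
  apply: h; exists j => //; apply/(cellP column_inj); split.
    by apply/(unf_ge0P column_inj); exists j.
  exact/lev0/(unf_bounds column_inj).
by apply/mem_set => -[t _ /(cellP column_inj) [u0 _]].
Qed.

Let measurable_off : measurable_fun [set: R] off.
Proof.
apply: measurable_indic; apply: measurableC; apply: bigcup_measurable => t _.
exact: measurable_cell.
Qed.

Let inLp_off m : inLp p (fun x => tr m x * off x).
Proof.
apply: (inLp_dominated p1 _ (ltr (lam m))).
  by apply: measurable_funM => //; exact: (ltr (lam m)).1.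
move=> x; rewrite normrM ler_piMr // offE.
by case: (_ < _); rewrite ?normr1 ?normr0.
Qed.

Definition off_mass m : R := fine (pint p (fun x => tr m x * off x)).

Lemma off_massE m : pint p (fun x => tr m x * off x) = (off_mass m)%:E.
Proof. by rewrite /off_mass pintE. Qed.

Lemma off_mass_bounds m : 0 <= off_mass m <= 1.
Proof.
rewrite -!lee_fin -off_massE pint_ge0 /=.
apply: le_trans (pint_translate_base p4 amp_gt0 lvl_le pos_le amp_sum (lam m)).
apply: (pint_le p1 (inLp_off m).1 (ltr (lam m)).1) => x.
by rewrite normrM ler_piMr // offE; case: (_ < _); rewrite ?normr1 ?normr0.
Qed.

Definition synth b B x : R := \sum_(m < B) b m * tr m x.

(** The increments of the martingale formed by the combination of atoms: the n-th atom without its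
    sign is constant on level-[n] intervals. *)
Definition diffs b n t : R :=
  b n * (amp n * (t %/ 2 ^ (n - lvl n) == pos n)%N%:R).

Local Notation mart b B := (dmart (fun=> 0) (diffs b) B).
Local Notation sqf b B := (sqfun (fun=> 0) (diffs b) B).

Let div_div B k l t : (k <= B)%N -> (l <= k)%N ->
  (t %/ 2 ^ (B - k) %/ 2 ^ (k - l) = t %/ 2 ^ (B - l))%N.
Proof. by move=> kB lk; rewrite -divnMA -expnD addnBA // subnK. Qed.

Lemma atoms_sumE b B x :
  \sum_(m < B) b m * atom m x = stepf column B (mart b B) x.
Proof.
rewrite /atom /stepf; case: ifPn => u0; last by rewrite big1 // => m _; rewrite mulr0.
rewrite dmartE add0r; apply: eq_bigr => m _.
rewrite (lev_div u0 (ltn_ord m)) /atom_val /diffs.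
rewrite !div_div ?ltn_ord // ?(ltnW (ltn_ord m)) // ?leqW //.
by ring.
Qed.

Lemma mart_supp b B t : (B * 2 ^ B <= t)%N -> mart b B t = 0.
Proof.
move=> Bt; rewrite dmartE add0r big1 // => k _.
rewrite /diffs div_div ?(ltnW (ltn_ord k)) //.
case: (_ %/ _ =P pos k)%N => [h|_]; last by rewrite !mulr0.
have : (B <= t %/ 2 ^ (B - lvl k))%N.
  rewrite leq_divRL ?expn_gt0 //; apply: leq_trans Bt.
  by rewrite leq_mul2l leq_exp2l // leq_subr orbT.
by rewrite h leqNgt (leq_ltn_trans (pos_le k) (ltn_ord k)).
Qed.

Definition mart_mass b B : R :=
  2^-1 ^+ B * \sum_(t < B * 2 ^ B) (mart b B t ^+ 2) `^ (p / 2).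

Definition sq_mass b B : R :=
  2^-1 ^+ B * \sum_(t < B * 2 ^ B) sqf b B t `^ (p / 2).

Let pow_off b B x : unf column x < 0 ->
  `|synth b B x| `^ p = \sum_(m < B) `|b m| `^ p * `|tr m x| `^ p.
Proof.
move=> u0; rewrite /synth.
have [[m [mB hm]]|h] := pselect (exists m, (m < B)%N /\ tr m x != 0).
  have z k : k != Ordinal mB -> tr (nat_of_ord k) x = 0.
    rewrite -val_eqE /= => km; apply/eqP; apply: contraNT km => hk.
    by apply/eqP; exact: translate_off_columns hk hm.
  rewrite (bigD1 (Ordinal mB)) //= [in RHS](bigD1 (Ordinal mB)) //=.
  rewrite !big1 ?addr0 ?normrM ?powRM //.
    by move=> k km; rewrite z // normr0 powR0 ?mulr0 // gt_eqF.
  by move=> k km; rewrite z // mulr0.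
have z (k : 'I_B) : tr k x = 0.
  by apply/eqP; apply: contrapT => /negP hk; apply: h; exists k.
rewrite !big1 ?normr0 ?powR0 // ?gt_eqF //.
  by move=> k _; rewrite z normr0 powR0 ?mulr0 // gt_eqF.
by move=> k _; rewrite z mulr0.
Qed.

Let synth_pow b B x : `|synth b B x| `^ p =
  `|stepf column B (mart b B) x| `^ p +
  \sum_(m < B) `|b m| `^ p * `|tr m x * off x| `^ p.
Proof.
have [u0|u0] := lerP 0 (unf column x).
  rewrite [X in _ + X]big1 ?addr0; last first.
    by move=> m _; rewrite offE ltNge u0 mulr0 normr0 powR0 ?mulr0 // gt_eqF.
  rewrite -atoms_sumE; congr (`|_| `^ _); apply: eq_bigr => m _.
  by rewrite translate_on_columns.
rewrite stepf_out // normr0 powR0 ?gt_eqF // add0r pow_off //.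
by apply: eq_bigr => m _; rewrite offE u0 mulr1.
Qed.

Lemma pint_synth b B : pint p (synth b B) =
  (mart_mass b B + \sum_(m < B) `|b m| `^ p * off_mass m)%:E.
Proof.
rewrite /pint; under eq_integral do rewrite synth_pow EFinD -sumEFin.
have mS : measurable_fun [set: R] (stepf column B (mart b B)).
  exact: (measurable_stepf column_inj _ (@mart_supp b B)).
have mT m : measurable_fun [set: R] (fun x => (`|b m| `^ p * `|tr m x * off x| `^ p)%:E).
  apply/measurable_EFinP; apply: measurable_funM => //.
  by apply/measurable_EFinP; exact: measurable_powR_norm (inLp_off m).1.
rewrite ge0_integralD //; last 3 first.
- exact: measurable_powR_norm.
- by move=> x _; apply: sume_ge0 => m _; rewrite lee_fin mulr_ge0 // powR_ge0.
- by apply: emeasurable_sum => m; exact: mT.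
rewrite EFinD; congr (_ + _)%E.
  rewrite -/(pint p _) (pint_stepf column_inj B p0 (@mart_supp b B)) /mart_mass.
  by under eq_bigr do rewrite powR_sqr.
rewrite ge0_integral_sum //; last by move=> m; exact: mT.
rewrite -sumEFin; apply: eq_bigr => m _.
under eq_integral do rewrite EFinM.
rewrite ge0_integralZl ?lee_fin ?powR_ge0 //; last first.
  exact: measurable_powR_norm (inLp_off m).1.
by rewrite EFinM -off_massE.
Qed.

Lemma sq_mass_le_mart b B : sq_mass b B <= Csq (p / 2) * mart_mass b B.
Proof.
rewrite /sq_mass /mart_mass mulrCA ler_wpM2l ?exprn_ge0 //.
exact: sqfun_le_dmart.
Qed.

Lemma mart_mass_le_sq b B : mart_mass b B <= Cmart (p / 2) * sq_mass b B.
Proof.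
rewrite /sq_mass /mart_mass mulrCA ler_wpM2l ?exprn_ge0 //.
exact: dmart_le_sqfun.
Qed.

Lemma sqf_synthE b B t : sqf b B t =
  \sum_(m < B) (b m * amp m) ^+ 2 * (t %/ 2 ^ (B - lvl m) == pos m)%N%:R.
Proof.
rewrite sqfunE expr0n /= add0r; apply: eq_bigr => m _.
rewrite /diffs div_div ?(ltnW (ltn_ord m)) // mulrA exprMn; congr (_ * _).
by rewrite -natrX; case: (_ == _).
Qed.

Lemma sq_mass_mono b b' B : (forall m, (m < B)%N -> b m ^+ 2 <= b' m ^+ 2) ->
  sq_mass b B <= sq_mass b' B.
Proof.
move=> h; rewrite ler_wpM2l ?exprn_ge0 //; apply: ler_sum => t _.
rewrite ge0_ler_powR ?nnegrE ?sqfun_ge0 //; first by rewrite ltW // (lt_trans _ r2).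
rewrite !sqf_synthE; apply: ler_sum => m _; rewrite ler_wpM2r //.
by rewrite !exprMn ler_wpM2r ?sqr_ge0 // h.
Qed.

End NormFormula.

Lemma cell_count (R : realType) B l q : (l <= B)%N -> (q < B * 2 ^ l)%N ->
  \sum_(t < B * 2 ^ B) (t %/ 2 ^ (B - l) == q)%N%:R = 2 ^+ (B - l) :> R.
Proof.
move=> lB qB; have -> : (B * 2 ^ B = B * 2 ^ l * 2 ^ (B - l))%N.
  by rewrite -mulnA -expnD subnKC.
rewrite (sum_divn (fun s => (s == q)%:R)) ?expn_gt0 //.
rewrite (bigD1 (Ordinal qB)) //= eqxx big1 ?addr0 ?natrX //.
by move=> s; rewrite -val_eqE /= => /negbTE ->; rewrite mul0rn.
Qed.

(** Superadditivity of the power [p / 2 > 1], integrated: a level-[l] interval consists of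
    [2 ^ (B - l)] cells of level [B]. It yields both the coordinate bounds and the control of the
    off-column term. *)
Lemma cells_lower_bound (R : realType) (p : R) n B (a : nat -> R) (lvl pos : nat -> nat) :
  2 < p -> (forall i, (i < n)%N -> (lvl i <= B)%N /\ (pos i < B * 2 ^ lvl i)%N) ->
  \sum_(i < n) `|a i| `^ p * 2^-1 ^+ lvl i <=
  2^-1 ^+ B * \sum_(t < B * 2 ^ B)
    (\sum_(i < n) a i ^+ 2 * (t %/ 2 ^ (B - lvl i) == pos i)%N%:R) `^ (p / 2).
Proof.
move=> p2 h.
have r1 : 1 < p / 2 by rewrite ltr_pdivlMr // mul1r.
have r0 : p / 2 != 0 by rewrite gt_eqF // (lt_trans _ r1).
apply: le_trans (_ : 2^-1 ^+ B * \sum_(t < B * 2 ^ B)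
  \sum_(i < n) (a i ^+ 2 * (t %/ 2 ^ (B - lvl i) == pos i)%N%:R) `^ (p / 2) <= _); last first.
  rewrite ler_wpM2l ?exprn_ge0 //; apply: ler_sum => t _.
  apply: powR_sum_superadditive => // i; by rewrite mulr_ge0 ?sqr_ge0.
rewrite exchange_big mulr_sumr; apply: ler_sum => i _.
have [lB pB] := h i (ltn_ord i).
rewrite (eq_bigr (fun t : 'I_(B * 2 ^ B) =>
    `|a i| `^ p * (t %/ 2 ^ (B - lvl i) == pos i)%N%:R)); last first.
  move=> t _; rewrite powR_sqr; case: (_ == _); first by rewrite !mulr1.
  by rewrite !mulr0 powR0.
rewrite -mulr_sumr cell_count // mulrCA ler_wpM2l ?powR_ge0 //.
rewrite !exprVn ler_pdivlMl ?exprn_gt0 // ler_pdivrMr ?exprn_gt0 //.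
by rewrite -exprD subnK.
Qed.

(** * Unconditionality *)

Section Unconditional.
Variables (R : realType) (p : R).
Hypothesis p4 : 4 < p.
Variables (amp : nat -> R) (lvl pos : nat -> nat).
Hypothesis amp_gt0 : forall m, 0 < amp m.
Hypothesis lvl_le : forall m, (lvl m <= m)%N.
Hypothesis pos_le : forall m, (pos m <= m)%N.
Hypothesis amp_sum : forall n, \sum_(m < n) amp m `^ p <= 1.

Local Notation base := (base amp lvl pos).
Local Notation synth := (synth amp lvl pos).
Local Notation sq_mass := (sq_mass p amp lvl pos).
Local Notation mart_mass := (mart_mass p amp lvl pos).
Local Notation off_mass := (off_mass p amp lvl pos).

Let p1 : 1 < p. Proof. by apply: lt_trans p4; rewrite ltr1n. Qed.
Let p1' : 1 <= p. Proof. exact: ltW. Qed.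
Let p0 : 0 < p. Proof. exact: lt_trans p1. Qed.
Let r2 : 2 < p / 2. Proof. by rewrite ltr_pdivlMr // -natrM. Qed.

Let ltr l : inLp p (translate base l).
Proof. exact: (inLp_translate_base p4 amp_gt0 lvl_le pos_le amp_sum). Qed.

Lemma sq_mass_coord b B m : (m < B)%N ->
  `|b m| `^ p * (amp m `^ p * 2^-1 ^+ lvl m) <= sq_mass b B.
Proof.
move=> mB.
have h := @cells_lower_bound R p B B (fun m => b m * amp m) lvl pos.
apply: le_trans (_ : \sum_(i < B) `|b i * amp i| `^ p * 2^-1 ^+ lvl i <= _).
  rewrite (bigD1 (Ordinal mB)) //= normrM powRM // (gtr0_norm (amp_gt0 m)) mulrA.
  by rewrite lerDl; apply: sumr_ge0 => k _; rewrite mulr_ge0 ?powR_ge0 ?exprn_ge0.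
apply: le_trans (h _ _) _; first by apply: lt_trans p4; rewrite ltr_nat.
  move=> i iB; split; first exact: leq_trans (lvl_le i) (ltnW iB).
  apply: leq_ltn_trans (pos_le i) (leq_trans iB _).
  by rewrite leq_pmulr // expn_gt0.
rewrite /sq_mass le_eqVlt; apply/orP; left; apply/eqP; congr (_ * _).
by apply: eq_bigr => t _; rewrite (sqf_synthE amp pos lvl_le).
Qed.

Definition restrict (F : seq int) (a : int -> R) m : R :=
  if lam m \in F then a (lam m) else 0.

Lemma lincomb_synthE F a B : uniq F ->
  (forall l, l \in F -> exists2 m, (m < B)%N & l = lam m) ->
  lincomb base F a = synth (restrict F a) B.
Proof.
move=> uF hF; pose G := [seq lam m | m <- iota 0 B].
have uG : uniq G by rewrite map_inj_uniq ?iota_uniq //; exact: lam_inj.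
have FG : {subset F <= G}.
  by move=> l /hF [m mB ->]; rewrite map_f // mem_iota.
rewrite -(lincomb_extend base a uF uG FG); apply/funext => x.
have iE : iota 0 B = index_iota 0 B by rewrite /index_iota subn0.
by rewrite /lincomb /G big_map /synth iE big_mkord.
Qed.

Lemma finsub_bound F : finsub (range lam) F ->
  exists B, forall l, l \in F -> exists2 m, (m < B)%N & l = lam m.
Proof.
move=> [_]; elim: F => [|l F IH] h; first by exists 0%N.
have [|B hB] := IH; first by move=> k kF; apply: h; rewrite inE kF orbT.
have := h l (mem_head _ _) => /set_mem [m _ ml].
exists (maxn m.+1 B) => k; rewrite inE => /orP[/eqP ->|/hB [n nB ->]].
  by exists m; rewrite ?leq_max ?leqnn.
by exists n; rewrite // leq_max nB orbT.
Qed.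

Let pint_lincomb F a B : uniq F ->
  (forall l, l \in F -> exists2 m, (m < B)%N & l = lam m) ->
  pint p (lincomb base F a) = (mart_mass (restrict F a) B +
    \sum_(m < B) `|restrict F a m| `^ p * off_mass m)%:E.
Proof.
move=> uF hF; rewrite (lincomb_synthE a uF hF).
exact: (pint_synth p4 amp_gt0 lvl_le pos_le amp_sum).
Qed.

Let off_ge0 m : 0 <= off_mass m.
Proof. by case/andP: (off_mass_bounds p4 amp_gt0 lvl_le pos_le amp_sum m). Qed.

Let mart_ge0 b B : 0 <= mart_mass b B.
Proof.
by rewrite mulr_ge0 ?exprn_ge0 // sumr_ge0 // => t _; rewrite powR_ge0.
Qed.

(** The product comes from going to the square function and back on the columns; the 1 covers the
    off-column term, which itself decreases when coefficients are dropped. *)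
Let suppress_const : R := (1 + Cmart (p / 2) * Csq (p / 2)) `^ p^-1.

Let suppress a F G : finsub (range lam) F -> finsub (range lam) G ->
  {subset F <= G} ->
  nrm p (lincomb base F a) <= suppress_const * nrm p (lincomb base G a).
Proof.
move=> fF fG FG.
have Cm := Cmart_gt0 r2; have Cs := Csq_gt0 r2.
have [B hB] := finsub_bound fG.
have hB' l : l \in F -> exists2 m, (m < B)%N & l = lam m by move=> /FG; exact: hB.
have [uF sF] := fF; have [uG sG] := fG.
apply: nrm_le_scaled => //; first exact: inLp_lincomb.
  by rewrite addr_ge0 // mulr_ge0 ?ltW.
rewrite (pint_lincomb a uF hB') (pint_lincomb a uG hB) -EFinM lee_fin.
set bF := restrict F a; set bG := restrict G a.
have bFG m : bF m ^+ 2 <= bG m ^+ 2 /\ `|bF m| `^ p <= `|bG m| `^ p.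
  rewrite /bF /bG /restrict; case: ifPn => [/FG ->//|_].
  by rewrite expr0n /= sqr_ge0 normr0 powR0 ?gt_eqF // powR_ge0.
have q1 := mart_mass_le_sq p4 amp lvl pos bF B.
have q2 : sq_mass bF B <= sq_mass bG B.
  by apply: (sq_mass_mono p4 amp pos lvl_le) => m _; exact: (bFG m).1.
have q3 := sq_mass_le_mart p4 amp lvl pos bG B.
have q4 : \sum_(m < B) `|bF m| `^ p * off_mass m <=
    \sum_(m < B) `|bG m| `^ p * off_mass m.
  by apply: ler_sum => m _; rewrite ler_wpM2r // (bFG m).2.
have q5 := ler_wpM2l (ltW Cm) (le_trans q2 q3).
have O0 : 0 <= \sum_(m < B) `|bG m| `^ p * off_mass m.
  by apply: sumr_ge0 => m _; rewrite mulr_ge0 // powR_ge0.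
have q6 : 0 <= Cmart (p / 2) * Csq (p / 2) * \sum_(m < B) `|bG m| `^ p * off_mass m.
  exact: mulr_ge0 (mulr_ge0 (ltW Cm) (ltW Cs)) O0.
have M0 := mart_ge0 bG B.
apply: le_trans (lerD (le_trans q1 q5) q4) _.
move: q6 M0; set X := mart_mass _ _; set Y := \sum_(m < B) _.
set k := Cmart _; set k' := Csq _ => q6 M0.
have -> : (1 + k * k') * (X + Y) = X + Y + k * (k' * X) + k * k' * Y by ring.
lra.
Qed.

(** A single term already bounds the square function from below. The constant worsens as amplitude
    and interval shrink, but the criterion lets it depend on [l]. *)
Let coord_const (l : int) : exists K, 0 <= K /\ forall a F,
  finsub (range lam) F -> l \in F -> `|a l| <= K * nrm p (lincomb base F a).
Proof.
have Cs := Csq_gt0 r2.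
have [[m _ <-{l}]|nl] := pselect (range lam l); last first.
  exists 0; split=> // a F [_ sF] lF; case: nl; exact: set_mem (sF _ lF).
set k := amp m `^ p * 2^-1 ^+ lvl m.
have k0 : 0 < k by rewrite mulr_gt0 ?powR_gt0 ?exprn_gt0.
have ck : 0 <= Csq (p / 2) / k := divr_ge0 (ltW Cs) (ltW k0).
exists ((Csq (p / 2) / k) `^ p^-1); split=> [|a F fF lF]; first exact: powR_ge0.
have [B hB] := finsub_bound fF; have [uF sF] := fF.
have mB : (m < B)%N by have [n nB /lam_inj ->] := hB _ lF.
have LL : inLp p (lincomb base F a) by exact: inLp_lincomb.
have N0 := nrm_ge0 p (lincomb base F a).
have -> : `|a (lam m)| = (`|a (lam m)| `^ p) `^ p^-1.
  by rewrite -powRrM mulfV ?gt_eqF // powRr1.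
have -> : nrm p (lincomb base F a) = (nrm p (lincomb base F a) `^ p) `^ p^-1.
  by rewrite -powRrM mulfV ?gt_eqF // powRr1.
rewrite -(powRM _ ck (powR_ge0 _ _)).
rewrite ge0_ler_powR ?nnegrE ?powR_ge0 ?invr_ge0 ?(ltW p0) //.
  exact: mulr_ge0 ck (powR_ge0 _ _).
have /eqP := pintE p1' LL; rewrite (pint_lincomb a uF hB) eqe => /eqP <-.
have := sq_mass_coord (restrict F a) mB; rewrite {1}/restrict lF -/k => q1.
have q2 := sq_mass_le_mart p4 amp lvl pos (restrict F a) B.
have O0 : 0 <= \sum_(m < B) `|restrict F a m| `^ p * off_mass m.
  by apply: sumr_ge0 => i _; rewrite mulr_ge0 // powR_ge0.
rewrite mulrAC ler_pdivlMr //; apply: le_trans q1 (le_trans q2 _).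
by rewrite ler_pM2l // lerDl.
Qed.

Lemma uncond_basic_base : uncond_basic p base (range lam).
Proof.
have [K hK] := choice coord_const.
apply: (@uncond_basicP R p p1' base (range lam) ltr suppress_const K).
- exact: powR_ge0.
- by move=> l; exact: (hK l).1.
- exact: suppress.
- by move=> a F l; exact: (hK l).2.
Qed.

End Unconditional.

(** The left side is [n ^ (4 - p)]. The bound serves twice: summed over [i] it makes the amplitudes
    p-summable with sum at most 1, and it is at most the length of the support of the i-th Haar
    item. *)
Lemma block_size_exists (R : realType) (p : R) i : 4 < p ->
  exists2 n : nat, (0 < n)%N & (n%:R^-1) `^ p *+ n ^ 4 <= 2^-1 ^+ i.+1.
Proof.
move=> p4.
have q0 : 0 < p - 4 by rewrite subr_gt0.
pose X : R := (2 ^+ i.+1) `^ (p - 4)^-1.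
exists (Num.truncn X).+1 => //; set n := _.+1.
have n0 : 0 < n%:R :> R by rewrite ltr0n.
have Xn : X <= n%:R by apply: ltW; exact: truncnS_gt.
have -> : (n%:R^-1 : R) `^ p *+ n ^ 4 = (n%:R `^ (p - 4))^-1.
  rewrite -mulr_natl natrX -powR_mulrn ?(ltW n0) // -powR_inv1 ?(ltW n0) //.
  rewrite -powRrM mulN1r -powRN opprB -powRD //.
  by rewrite (gt_eqF n0) implybT.
rewrite exprVn lef_pV2 ?posrE ?powR_gt0 ?exprn_gt0 //.
have -> : 2 ^+ i.+1 = X `^ (p - 4) :> R.
  by rewrite /X -powRrM mulVf ?gt_eqF // powRr1 // exprn_ge0.
by rewrite ge0_ler_powR ?nnegrE ?powR_ge0 // ltW.
Qed.

(* Together with [unf], a bijection nat -> int turns L_p(R) into L_p of the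
   half-line. *)
Definition zint (n : nat) : int := if odd n then Negz n./2 else Posz n./2.

Lemma zint_inj : injective zint.
Proof.
move=> m n; have := odd_double_half m; have := odd_double_half n; rewrite /zint.
by case: (odd m); case: (odd n) => //= hn hm [h]; rewrite -hm -hn h.
Qed.

Lemma zint_surj k : exists n, zint n = k.
Proof.
case: k => k; first by exists k.*2; rewrite /zint odd_double doubleK.
by exists k.*2.+1; rewrite /zint /= odd_double /= uphalf_double.
Qed.

(** For each first code [k] only the position [tau k] contributes, which turns a sum over items into
    a sum over levels; [K >= I] levels suffice since [dec1 i <= i]. *)
Lemma sum_decode (R : realType) (c : nat -> R) (tau : nat -> nat) (sigma : nat -> R) I K :
  (I <= K)%N ->
  \sum_(i < I) c i * ((tau (dec1 i) == dec2 i)%N%:R * sigma (dec1 i)) =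
  \sum_(k < K) cutoff I c (enc k (tau k)) * sigma k.
Proof.
move=> IK.
have cE j : cutoff I c j = \sum_(i < I) c i * (i == j :> nat)%:R.
  rewrite /cutoff; case: ifPn => jI.
    rewrite (bigD1 (Ordinal jI)) //= eqxx mulr1 big1 ?addr0 // => i.
    by rewrite -val_eqE /= => /negbTE ->; rewrite mulr0.
  rewrite big1 // => i _; case: eqP => [ij|]; last by rewrite mulr0.
  by move: jI; rewrite -ij ltn_ord.
under [RHS]eq_bigr do rewrite cE mulr_suml.
rewrite exchange_big; apply: eq_bigr => i _ /=.
have iK : (dec1 i < K)%N by apply: leq_ltn_trans (dec1_le i) (leq_trans (ltn_ord i) IK).
rewrite (bigD1 (Ordinal iK)) //= big1 ?addr0; last first.
  move=> k; rewrite -val_eqE /= => ki; case: eqP => [ik|]; last by rewrite mulr0 mul0r.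
  by move: ki; rewrite ik dec1_enc eqxx.
rewrite -mulrA; congr (_ * (_%:R * _)); congr nat_of_bool.
by apply/eqP/eqP => [ti|it]; [rewrite ti decK|rewrite {2}it dec2_enc].
Qed.

(** * The embedding of L_p *)

Section Embedding.
Variables (R : realType) (p : R).
Hypothesis p4 : 4 < p.

Let p1 : 1 < p. Proof. by apply: lt_trans p4; rewrite ltr1n. Qed.
Let p1' : 1 <= p. Proof. exact: ltW. Qed.
Let p0 : 0 < p. Proof. exact: lt_trans p1. Qed.
Let r2 : 2 < p / 2. Proof. by rewrite ltr_pdivlMr // -natrM. Qed.

Variable size : nat -> nat.
Hypothesis size_gt0 : forall i, (0 < size i)%N.
Hypothesis size_large : forall i,
  ((size i)%:R^-1) `^ p *+ size i ^ 4 <= 2^-1 ^+ i.+1 :> R.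

Let Nb i := (size i ^ 4)%N.

Let Nb_gt0 i : (0 < Nb i)%N. Proof. by rewrite expn_gt0 size_gt0. Qed.

Local Notation block := (blk Nb_gt0).

Definition bamp m : R := (size (block m))%:R^-1.
(** The truncated predecessor is intended: first codes 0 and 1 both stand for functions supported on
    a unit interval, of level 0. *)
Definition blvl m : nat := (dec1 (block m)).-1.
Definition bpos m : nat := dec2 (block m).

Lemma bamp_gt0 m : 0 < bamp m.
Proof. by rewrite invr_gt0 ltr0n. Qed.

Lemma blvl_le m : (blvl m <= m)%N.
Proof. exact: leq_trans (leq_pred _) (leq_trans (dec1_le _) (blk_le Nb_gt0 m)). Qed.

Lemma bpos_le m : (bpos m <= m)%N.
Proof. exact: leq_trans (dec2_le _) (blk_le Nb_gt0 m). Qed.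

Lemma bamp_sum n : \sum_(m < n) bamp m `^ p <= 1.
Proof.
apply: le_trans (_ : \sum_(m < offset Nb n) bamp m `^ p <= _).
  rewrite (big_ord_widen (offset Nb n) (fun m => bamp m `^ p)) ?leq_offset //.
  by rewrite big_mkcond; apply: ler_sum => m _; case: ifP => // _; rewrite powR_ge0.
rewrite (sum_blocks Nb_gt0 (fun i => ((size i)%:R^-1 : R) `^ p)).
apply: le_trans (_ : \sum_(i < n) 2^-1 ^+ i.+1 <= _); first exact: ler_sum.
have : \sum_(i < n) 2^-1 ^+ i.+1 = 1 - 2^-1 ^+ n :> R.
  elim: n => [|n IH]; first by rewrite big_ord0 expr0 subrr.
  by rewrite big_ord_recr /= IH exprS; lra.
by move=> ->; rewrite gerBl exprn_ge0.
Qed.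

Local Notation base := (base bamp blvl bpos).
Local Notation synth := (synth bamp blvl bpos).

Let ltr l : inLp p (translate base l).
Proof. exact: (inLp_translate_base p4 bamp_gt0 blvl_le bpos_le bamp_sum). Qed.

Definition block_sum i x : R :=
  \sum_(u < Nb i) (size i)%:R^-1 * translate base (lam (offset Nb i + u)) x.

(* Item i encodes the pair (dec1 i, dec2 i): for dec1 i = 0 the indicator of
   the dec2 i-th unit interval, and for dec1 i = k + 1 the Haar function of the
   dec2 i-th dyadic interval of level k. *)
Definition haar_val i t : R :=
  if dec1 i is _.+1 then (t./2 == dec2 i)%:R * (-1) ^+ odd t
  else (t == dec2 i)%:R.

Definition haar i : R -> R := stepf zint (dec1 i) (haar_val i).

(** [bamp m] appears here as the coefficient inside [block_sum], which is chosen equal to the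
    amplitude. *)
Let coef (c : nat -> R) m : R := c (block m) * bamp m.

Lemma comb_block_sum I c : comb block_sum I c = synth (coef c) (offset Nb I).
Proof.
apply/funext => x; rewrite /comb /synth; elim: I => [|I IH].
  by rewrite [offset Nb 0]big_ord0 !big_ord0.
rewrite big_ord_recr /= IH offsetS big_split_ord /=; congr (_ + _).
rewrite /block_sum mulr_sumr; apply: eq_bigr => u _.
have bu : block (offset Nb I + u) = I.
  by apply/eqP; rewrite blkP leq_addr /= offsetS ltn_add2l.
by rewrite /coef /bamp bu mulrA.
Qed.

Let f0 I c t : R := cutoff I c (enc 0 t).
Let df I c k t : R := cutoff I c (enc k.+1 t).

Lemma haar_supp i t : ((dec2 i).+1 * 2 ^ dec1 i <= t)%N -> haar_val i t = 0.
Proof.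
rewrite /haar_val; case: (dec1 i) => [|k].
  by rewrite expn0 muln1 => h; case: eqP => // ti; move: h; rewrite ti ltnn.
rewrite expnS => h; case: eqP => [ti|_]; last by rewrite mul0r.
suff : (dec2 i < t./2)%N by rewrite ti ltnn.
rewrite -divn2 leq_divRL //; apply: leq_trans h.
by rewrite leq_mul2l /= leq_pmulr // expn_gt0.
Qed.

Lemma inLp_haar i : inLp p (haar i).
Proof.
apply: (inLpP p1' _).2; split.
  exact: (measurable_stepf zint_inj _ (@haar_supp i)).
by rewrite (pint_stepf zint_inj _ p0 (@haar_supp i)) ltry.
Qed.

Lemma inLp_block_sum i : inLp p (block_sum i).
Proof.
by apply: (@inLp_sum _ _ p1' _ _ (fun (u : 'I_(Nb i)) x =>
  (size i)%:R^-1 * translate base (lam (offset Nb i + u)) x)) => u; exact: inLpZ.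
Qed.

Lemma comb_haarE I B c x : (I <= B)%N ->
  comb haar I c x = stepf zint B (dmart (f0 I c) (df I c) B) x.
Proof.
move=> IB; rewrite /comb /haar /stepf; case: ifPn => u0; last first.
  by rewrite big1 // => i _; rewrite mulr0.
set s := lev B _.
(* On the cell [s], the only possibly nonzero item of first code [k] is the one at position [tau k],
   and its value there is [sigma k]. *)
pose tau k := (s %/ 2 ^ (B - k.-1))%N.
pose sigma k : R := if k is k'.+1 then (-1) ^+ odd (s %/ 2 ^ (B - k))%N else 1.
have iB (i : 'I_I) : (dec1 i < B)%N.
  by apply: leq_ltn_trans (dec1_le i) (leq_trans (ltn_ord i) IB).
rewrite (eq_bigr (fun i : 'I_I => c i * ((tau (dec1 i) == dec2 i)%N%:R * sigma (dec1 i)))).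
  rewrite (sum_decode c tau sigma (leqW IB)) big_ord_recl dmartE.
  rewrite /f0 /tau /sigma /= subn0 mulr1; congr (_ + _).
  by apply: eq_bigr => k _; rewrite /bump leq0n add1n /= mulrC.
move=> i _; congr (_ * _); rewrite (lev_div u0 (ltnW (iB i))) -/s /haar_val /tau /sigma.
case: (dec1 i) (iB i) => [|k] kB; first by rewrite mulr1.
by rewrite /= -divn2 -divnMA -expnSr subnSK // ltnW.
Qed.

Lemma mart_haar_supp I B c t : (I <= B)%N -> (B * 2 ^ B <= t)%N ->
  dmart (f0 I c) (df I c) B t = 0.
Proof.
move=> IB Bt.
have big k q : (B <= q)%N -> cutoff I c (enc k q) = 0.
  move=> Bq; rewrite /cutoff ltnNge (leq_trans IB) //.
  by apply: leq_trans Bq _; rewrite -{1}(dec2_enc k q) dec2_le.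
have tB k : (k <= B)%N -> (B <= t %/ 2 ^ (B - k))%N.
  move=> kB; rewrite leq_divRL ?expn_gt0 //; apply: leq_trans Bt.
  by rewrite leq_mul2l leq_exp2l // leq_subr orbT.
rewrite dmartE /f0 big ?add0r; last by have := tB 0%N (leq0n B); rewrite subn0.
by rewrite big1 // => k _; rewrite /df big ?mulr0 // tB // ltnW.
Qed.

Definition haar_mass I c B : R :=
  2^-1 ^+ B * \sum_(t < B * 2 ^ B) (dmart (f0 I c) (df I c) B t ^+ 2) `^ (p / 2).

Lemma pint_comb_haar I B c : (I <= B)%N ->
  pint p (comb haar I c) = (haar_mass I c B)%:E.
Proof.
move=> IB; have -> : comb haar I c = stepf zint B (dmart (f0 I c) (df I c) B).
  by apply/funext => x; exact: comb_haarE.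
rewrite (pint_stepf zint_inj B p0 (fun t => @mart_haar_supp I B c t IB)) /haar_mass.
by under eq_bigr do rewrite powR_sqr.
Qed.

(** The common square function of a Haar combination and of its image; [t] numbers cells over [zint]
    for the former and over [column] for the latter. *)
Let sq_items I (c : nat -> R) B t : R :=
  \sum_(i < I) c i ^+ 2 * (t %/ 2 ^ (B - (dec1 i).-1) == dec2 i)%N%:R.

Let sq_haarE I c B t : (I <= B)%N ->
  sqfun (f0 I c) (df I c) B t = sq_items I c B t.
Proof.
move=> IB; pose tau k := (t %/ 2 ^ (B - k.-1))%N.
rewrite /sq_items (eq_bigr (fun i : 'I_I =>
    c i ^+ 2 * ((tau (dec1 i) == dec2 i)%N%:R * 1))); last first.
  by move=> i _; rewrite mulr1.
rewrite (sum_decode (fun i => c i ^+ 2) tau (fun=> 1) (leqW IB)).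
have csq j : cutoff I (fun i => c i ^+ 2) j * 1 = cutoff I c j ^+ 2.
  by rewrite mulr1 /cutoff; case: ifP => // _; rewrite expr0n.
under eq_bigr do rewrite csq.
rewrite big_ord_recl sqfunE /f0 /tau /= subn0; congr (_ + _).
Qed.

Let sq_blockE I c t : let B := offset Nb I in
  sqfun (fun=> 0) (diffs bamp blvl bpos (coef c)) B t = sq_items I c B t.
Proof.
move=> B; rewrite (sqf_synthE bamp bpos blvl_le) /coef /bamp /blvl /bpos.
rewrite (sum_blocks Nb_gt0 (fun i => (c i * (size i)%:R^-1 / (size i)%:R) ^+ 2 *
  (t %/ 2 ^ (B - (dec1 i).-1) == dec2 i)%N%:R)).
apply: eq_bigr => i _; rewrite -[_ *+ Nb i]mulr_natl mulrA; congr (_ * _).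
rewrite /Nb natrX; field.
by rewrite pnatr_eq0 -lt0n.
Qed.

(** Summed over block [i], the p-th powers of the coefficients are at most [|c i| ^ p] times the
    length of the support of item [i], and [cells_lower_bound] compares this with the square
    function. *)
Let off_bound I c B : B = offset Nb I ->
  \sum_(m < B) `|coef c m| `^ p * off_mass p bamp blvl bpos m <=
  2^-1 ^+ B * \sum_(t < B * 2 ^ B) sq_items I c B t `^ (p / 2).
Proof.
move=> BE.
have IB : (I <= B)%N by rewrite BE leq_offset.
apply: (@le_trans _ _ (\sum_(i < I) `|c i| `^ p * 2^-1 ^+ (dec1 i).-1)); last first.
  apply: (@cells_lower_bound R p I B c (fun i => (dec1 i).-1) dec2).
    by apply: lt_trans p4; rewrite ltr_nat.
  move=> i iI; have di := dec1_le i; have di' := dec2_le i; split.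
    exact: leq_trans (leq_pred _) (leq_trans di (leq_trans (ltnW iI) IB)).
  apply: leq_ltn_trans di' _; apply: leq_trans iI (leq_trans IB _).
  by rewrite leq_pmulr // expn_gt0.
apply: (@le_trans _ _ (\sum_(m < B) `|c (block m)| `^ p * (bamp m) `^ p)).
  apply: ler_sum => m _; rewrite /coef normrM powRM // (gtr0_norm (bamp_gt0 m)).
  rewrite ler_piMr ?mulr_ge0 ?powR_ge0 //.
  by case/andP: (off_mass_bounds p4 bamp_gt0 blvl_le bpos_le bamp_sum m).
rewrite BE (sum_blocks Nb_gt0 (fun i => `|c i| `^ p * ((size i)%:R^-1) `^ p)).
apply: ler_sum => i _; rewrite -mulrnAr ler_wpM2l ?powR_ge0 //.
apply: le_trans (size_large i) _; apply: ler_wiXn2l; rewrite ?invr_ge0 //.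
  by rewrite invf_le1 // ler1n.
exact: leq_trans (leq_pred _) (leqW (dec1_le i)).
Qed.

Let K1 := Cmart (p / 2).
Let K2 := Csq (p / 2).

(** The route is from the Haar combination to the common square function and on to the image; the
    off-column term only helps. *)
Let pint_lower I c :
  (pint p (comb haar I c) <= (K1 * K2)%:E * pint p (comb block_sum I c))%E.
Proof.
set B := offset Nb I.
have IB : (I <= B)%N by exact: leq_offset.
have c1 := Cmart_gt0 r2; have c2 := Csq_gt0 r2.
rewrite (pint_comb_haar c IB) comb_block_sum.
rewrite (pint_synth p4 bamp_gt0 blvl_le bpos_le bamp_sum) -EFinM lee_fin.
set O := \sum_(m < B) _.
have O0 : 0 <= O.
  apply: sumr_ge0 => m _; apply: mulr_ge0; first exact: powR_ge0.
  by case/andP: (off_mass_bounds p4 bamp_gt0 blvl_le bpos_le bamp_sum m).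
have q1 : haar_mass I c B <= K1 * sq_mass p bamp blvl bpos (coef c) B.
  rewrite /haar_mass /sq_mass mulrCA ler_wpM2l ?exprn_ge0 //.
  apply: le_trans (dmart_le_sqfun _ _ B B r2) _; rewrite ler_pM2l //.
  by apply: ler_sum => t _; rewrite sq_haarE // -sq_blockE.
have q2 := sq_mass_le_mart p4 bamp blvl bpos (coef c) B.
apply: le_trans q1 _; rewrite -(mulrA K1 K2); apply: ler_wpM2l; first exact: ltW.
apply: le_trans q2 _.
by apply: ler_wpM2l; [exact: ltW|rewrite lerDl].
Qed.

(** Here the off-column term has to be paid for, which adds 1 to [K1]. *)
Let pint_upper I c :
  (pint p (comb block_sum I c) <= ((K1 + 1) * K2)%:E * pint p (comb haar I c))%E.
Proof.
set B := offset Nb I.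
have IB : (I <= B)%N by exact: leq_offset.
have c1 := Cmart_gt0 r2; have c2 := Csq_gt0 r2.
rewrite (pint_comb_haar c IB) comb_block_sum.
rewrite (pint_synth p4 bamp_gt0 blvl_le bpos_le bamp_sum) -EFinM lee_fin.
set S := 2^-1 ^+ B * \sum_(t < B * 2 ^ B) sq_items I c B t `^ (p / 2).
have q1 : S <= K2 * haar_mass I c B.
  rewrite /haar_mass /S mulrCA ler_wpM2l ?exprn_ge0 //.
  apply: le_trans (sqfun_le_dmart _ _ B B r2).
  by apply: ler_sum => t _; rewrite sq_haarE.
have q2 : sq_mass p bamp blvl bpos (coef c) B = S.
  by rewrite /sq_mass /S; congr (_ * _); apply: eq_bigr => t _; rewrite sq_blockE.
have q3 := mart_mass_le_sq p4 bamp blvl bpos (coef c) B.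
rewrite q2 in q3.
apply: le_trans (lerD q3 (off_bound c (erefl B))) _; rewrite -/S.
have k1 : 0 <= K1 + 1 by rewrite addr_ge0 // ltW.
apply: le_trans (_ : (K1 + 1) * S <= _); first by rewrite mulrDl mul1r.
by rewrite -(mulrA (K1 + 1) K2); exact: ler_wpM2l.
Qed.

(** By induction on the level: the indicator of a child is half of the parent's indicator plus or
    minus half of the parent's Haar function. *)
Lemma indicator_in_span N t : forall e, 0 < e -> exists I c,
  nrm p (fun x => stepf zint N (fun s => (s == t)%:R) x - comb haar I c x) < e.
Proof.
move=> e e0; suff [I [c hc]] : exists I c,
    stepf zint N (fun s => (s == t)%:R : R) = comb haar I c.
  exists I, c; rewrite hc (@eq_nrm _ _ _ (fun=> 0)) ?nrm0 // => x; exact: subrr.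
have single i : exists I c, haar i = comb haar I c.
  exists i.+1, (fun j => (j == i)%:R); apply/funext => x.
  rewrite /comb big_ord_recr /= eqxx mul1r big1 ?add0r // => j _.
  by rewrite ltn_eqF // mul0r.
elim: N t => [|N IH] t.
  have [I [c hc]] := single (enc 0 t); exists I, c; rewrite -hc /haar dec1_enc.
  by congr stepf; apply/funext => s; rewrite /haar_val dec1_enc dec2_enc.
have [I [c hc]] := IH t./2; have [J [d hd]] := single (enc N.+1 t./2).
have [M [c' [d' [hc' hd']]]] := comb_common haar I J c d.
exists M, (fun i => ((-1) ^+ odd t / 2) * d' i + 2^-1 * c' i); apply/funext => x.
rewrite comb_linear -hd' -hd /comb.
have -> : \sum_(i < M) 2^-1 * c' i * haar i x = 2^-1 * comb haar M c' x.
  by rewrite /comb mulr_sumr; apply: eq_bigr => i _; rewrite mulrA.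
rewrite -hc' -hc (stepf_refine zint _ _ (leqnSn N)) /haar dec1_enc /stepf.
case: ifP => _; last by rewrite !mulr0 addr0.
rewrite /haar_val dec1_enc dec2_enc subSnn expn1 divn2; set s := lev _ _.
have -> : (s == t) = (s./2 == t./2) && (odd s == odd t).
  apply/eqP/andP => [->|[/eqP h1 /eqP h2]]; first by rewrite !eqxx.
  by rewrite -(odd_double_half s) -(odd_double_half t) h1 h2.
case: (s./2 == t./2) => /=; last by rewrite mul0r !mulr0 addr0.
by case: (odd s); case: (odd t); rewrite /= ?expr0 ?expr1; field.
Qed.

Let in_span g := inLp p g /\
  forall e, 0 < e -> exists I c, nrm p (fun x => g x - comb haar I c x) < e.

Lemma haar_dense g : inLp p g -> forall e, 0 < e ->
  exists I c, nrm p (fun x => g x - comb haar I c x) < e.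
Proof.
move=> lg; suff : in_span g by case.
have lc I c : inLp p (comb haar I c) by apply: inLp_comb => // i; exact: inLp_haar.
apply: (@Lp_dense R p p1 in_span) lg => [f h k [lf hf] [lh hh]|f lf hf|N k].
- have lkf : inLp p (fun x => k * f x) by exact: inLpZ.
  split=> [|e e0]; first exact: inLpD.
  pose d := e / (1 + `|k| + 1).
  have k0 : 0 < 1 + `|k| + 1 by rewrite ltr_pwDr // addr_ge0.
  have d0 : 0 < d by rewrite divr_gt0.
  have [I [c hc]] := hf d d0; have [J [c' hc']] := hh d d0.
  have [M [a [a' [ea ea']]]] := comb_common haar I J c c'.
  exists M, (fun i => k * a i + a' i).
  rewrite (@eq_nrm _ _ _ (fun x => k * (f x - comb haar I c x) +
      (h x - comb haar J c' x))); last first.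
    by move=> x; rewrite comb_linear -ea -ea'; ring.
  have l1 : inLp p (fun x => f x - comb haar I c x) by exact: inLpB.
  have l2 : inLp p (fun x => h x - comb haar J c' x) by exact: inLpB.
  apply: le_lt_trans (nrmD p1' (inLpZ p1' k l1) l2) _; rewrite nrmZ //.
  have q : `|k| * nrm p (fun x => f x - comb haar I c x) <= `|k| * d.
    by apply: ler_wpM2l => //; exact: ltW.
  have -> : e = (1 + `|k| + 1) * d by rewrite /d; field; rewrite gt_eqF.
  by rewrite !mulrDl !mul1r; lra.
- split=> // e e0; have e2 : 0 < e / 2 by rewrite divr_gt0.
  have [phi [lphi [_ hphi] nphi]] := hf _ e2.
  have [I [c hc]] := hphi _ e2; exists I, c.
  by apply: le_lt_trans (nrm_triangle p1' lf lphi (lc I c)) _; lra.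
have P0 : 0 < Posz (2 ^ N)%N by rewrite ltz_nat expn_gt0.
have [a ha] := zint_surj (k %/ Posz (2 ^ N)%N)%Z.
pose t := absz (k %% Posz (2 ^ N)%N)%Z.
have tE : Posz t = (k %% Posz (2 ^ N)%N)%Z by rewrite gez0_abs // modz_ge0 // gt_eqF.
have kE : k = zint a * Posz (2 ^ N)%N + Posz t by rewrite ha tE -divz_eq.
have tN : (t < 2 ^ N)%N by rewrite -ltz_nat tE ltz_pmod.
(* [zint a] is the integer part of the left end [k / 2 ^ N] and [t] the position within that unit
   interval, so [q] numbers the cell over [zint]. *)
pose q := (a * 2 ^ N + t)%N.
have q1 : (q %/ 2 ^ N = a)%N by rewrite divnMDl ?expn_gt0 // divn_small // addn0.
have q2 : (q %% 2 ^ N = t)%N by rewrite modnMDl modn_small.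
have N0 : 0 < 2 ^+ N :> R by rewrite exprn_gt0.
have ind : dyadic_ind N k 1 = stepf zint N (fun s => (s == q)%:R) :> (R -> R).
  apply/funext => x.
  have cellE : cell zint N q x = (k%:~R / 2 ^+ N <= x < (k + 1)%:~R / 2 ^+ N).
    rewrite /cell /= in_itv /= q1 q2.
    have -> : (zint a)%:~R + t%:R / 2 ^+ N = k%:~R / 2 ^+ N :> R.
      by rewrite kE intrD intrM -!pmulrn natrX; field; rewrite gt_eqF.
    have -> // : (zint a)%:~R + t.+1%:R / 2 ^+ N = (k + 1)%:~R / 2 ^+ N :> R.
    by rewrite kE !intrD intrM -!pmulrn natrX -natr1; field; rewrite gt_eqF.
  rewrite /dyadic_ind.
  have [xc|xc] := boolP (k%:~R / 2 ^+ N <= x < (k + 1)%:~R / 2 ^+ N).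
    by rewrite (@stepf_cell R zint zint_inj N _ q x) ?eqxx ?cellE.
  rewrite /stepf; case: ifP => // u0; case: eqP => // sq; case/negP: xc.
  by rewrite -cellE; apply/(cellP zint_inj).
rewrite ind; split; last by move=> e; exact: indicator_in_span.
have supp s : (q.+1 <= s)%N -> (s == q)%:R = 0 :> R by move=> qs; rewrite gtn_eqF.
apply: (inLpP p1' _).2; split; first exact: (measurable_stepf zint_inj _ supp).
by rewrite (pint_stepf zint_inj _ p0 supp) ltry.
Qed.

Lemma inLp_comb_block_sum I c : inLp p (comb block_sum I c).
Proof. by apply: inLp_comb => // i; exact: inLp_block_sum. Qed.

Lemma block_sum_lincomb I c : exists F a,
  finsub (range lam) F /\ comb block_sum I c = lincomb base F a.
Proof.
(* Coefficients in [lincomb] are indexed by integers, so [lam] has to be inverted on its range. *)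
have /choice[inv hinv] : forall l, exists m, range lam l -> lam m = l.
  move=> l; have [[m _ ml]|nl] := pselect (range lam l); first by exists m.
  by exists 0%N.
pose B := offset Nb I; pose F := [seq lam m | m <- iota 0 B].
exists F, (fun l => coef c (inv l)); split.
  split; first by rewrite map_inj_uniq ?iota_uniq //; exact: lam_inj.
  by move=> l /mapP [m _ ->]; apply/mem_set; exists m.
rewrite comb_block_sum; apply/funext => x.
have iE : iota 0 B = index_iota 0 B by rewrite /index_iota subn0.
rewrite /lincomb /F big_map /synth iE big_mkord; apply: eq_bigr => m _.
by congr (coef c _ * _); apply: lam_inj; rewrite hinv //; exists m.
Qed.

Lemma contains_Lp_copy_base : contains_Lp_copy p (Xp p base (range lam)).
Proof.
have c1 := Cmart_gt0 r2; have c2 := Csq_gt0 r2.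
have k1 : 0 < K1 * K2 by exact: mulr_gt0.
have k2 : 0 < (K1 + 1) * K2 by apply: mulr_gt0 => //; apply: addr_gt0.
apply: (@contains_Lp_copyP R p p1 haar block_sum _
  ((K1 * K2) `^ p^-1)^-1 (((K1 + 1) * K2) `^ p^-1)).
- exact: inLp_haar.
- exact: inLp_block_sum.
- by rewrite invr_gt0 powR_gt0.
- by rewrite powR_gt0.
- move=> I c; rewrite ler_pdivrMl ?powR_gt0 //.
  by apply: nrm_le_scaled (pint_lower I c) => //; [exact: inLp_comb_block_sum|exact: ltW].
- move=> I c; apply: nrm_le_scaled (pint_upper I c) => //; last exact: ltW.
  by apply: inLp_comb => // i; exact: inLp_haar.
- exact: haar_dense.
- move=> v lv hv; split=> // e e0; have [I [c hc]] := hv e e0.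
  have [F [a [fF Fa]]] := block_sum_lincomb I c.
  exists F, a; split=> //; rewrite -Fa Lpnorm_lt //.
  exact/inLpB/inLp_comb_block_sum.
Qed.

End Embedding.

Theorem theorem2p15 (R : realType) (p : R) (hp : 4 < p) :
  exists (f : R -> R) (Lam : set int),
    inLp p f /\ uncond_basic p f Lam /\ contains_Lp_copy p (Xp p f Lam).
Proof.
have /choice[size hsize] : forall i, exists n : nat,
    (0 < n)%N /\ (n%:R^-1 : R) `^ p *+ n ^ 4 <= 2^-1 ^+ i.+1.
  by move=> i; have [n n0 hn] := block_size_exists i hp; exists n.
have s0 i : (0 < size i)%N := (hsize i).1.
have sl i := (hsize i).2.
have agt0 := bamp_gt0 R s0; have asum := bamp_sum s0 sl.
have lle := blvl_le s0; have ple := bpos_le s0.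
exists (base (bamp R s0) (blvl s0) (bpos s0)), (range lam).
split; first exact: (inLp_base hp agt0 lle ple asum).
split; first exact: (uncond_basic_base hp agt0 lle ple asum).
exact: (@contains_Lp_copy_base R p hp size s0 sl).
Qed.
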